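(* Let $G$ be a finite simple $2$-connected graph. If $G$ is $\{K_{1,3},N_{1,1,2},D\}$-heavy, then $G$ is Hamiltonian.
   Context: Let $G$ be a graph on $n$ vertices. An induced subgraph $H'$ of $G$ is called heavy if there exist two nonadjacent vertices in $H'$ whose degree sum in $G$ is at least $n$. For a graph $H$, $G$ is $H$-heavy if every induced subgraph of $G$ isomorphic to $H$ is heavy; for a family $\mathcal{H}$, $G$ is $\mathcal{H}$-heavy if it is $H$-heavy for every $H\in\mathcal{H}$. $K_{1,3}$ is the claw (star with three leaves). $N_{1,1,2}$ is the graph on 7 vertices obtained from a triangle $abc$ by attaching a pendant edge at $a$, a pendant edge at $b$, and a pendant path of length $2$ at $c$. $D$ (the ''deer'') is the graph on 7 vertices obtained from a triangle $abc$ by attaching a pendant path of length $2$ at $a$ and a pendant path of length $2$ at $b$ (the vertex $c$ has degree $2$). *)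

(* Defs.v *)
From mathcomp Require Import all_boot.
From Stdlib Require List.

Set Implicit Arguments.
Unset Strict Implicit.
Unset Printing Implicit Defensive.

(** Finite simple graphs. *)
Record sgraph := SGraph {
  svertex :> finType;
  sedge : rel svertex;
  sedge_sym : symmetric sedge;
  sedge_irrefl : irreflexive sedge
}.

Section Graph.
Variable G : sgraph.

Definition degree (x : G) : nat := #|[set y | sedge x y]|.

Section Induced.
Variable A : {set G}.

Definition induced_rel : rel {x : G | x \in A} :=
  fun x y => sedge (val x) (val y).

Lemma induced_rel_sym : symmetric induced_rel.
Proof. by move=> x y; apply: sedge_sym. Qed.

Lemma induced_rel_irrefl : irreflexive induced_rel.
Proof. by move=> x; apply: sedge_irrefl. Qed.

Definition induced : sgraph := SGraph induced_rel_sym induced_rel_irrefl.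
End Induced.

Definition connected : Prop := forall x y : G, connect (@sedge G) x y.

(** The bound 3 rules out the closed walk x, y, x along a single edge, which
    [ucycle] accepts. *)
Definition hamiltonian : Prop :=
  exists c : seq G, [/\ ucycle (@sedge G) c, 3 <= size c & forall x, x \in c].

(** Heaviness of the induced subgraph G[A]: both the degrees and the number of
    vertices are those of G, not of G[A]. *)
Definition heavy (A : {set G}) : Prop :=
  exists x y : G, [/\ x \in A, y \in A, x != y, ~~ sedge x y
                    & #|G| <= degree x + degree y].

End Graph.

Definition isomorphic (F G : sgraph) : Prop :=
  exists2 f : F -> G, bijective f & forall x y, sedge (f x) (f y) = sedge x y.

(** More than k vertices, and no fewer than k vertices disconnect G; in
    particular a 2-connected graph has at least three vertices. *)
Definition k_connected (k : nat) (G : sgraph) : Prop :=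
  k < #|G| /\ forall S : {set G}, #|S| < k -> connected (induced (~: S)).

Definition graph_heavy (H G : sgraph) : Prop :=
  forall A : {set G}, isomorphic (induced A) H -> heavy A.

Definition family_heavy (Hs : seq sgraph) (G : sgraph) : Prop :=
  forall H : sgraph, List.In H Hs -> graph_heavy H G.

Section EdgeList.
Variables (n : nat) (s : seq (nat * nat)).

Definition edge_list_rel : rel 'I_n := fun i j =>
  (i != j) && (((val i, val j) \in s) || ((val j, val i) \in s)).

Lemma edge_list_rel_sym : symmetric edge_list_rel.
Proof. by move=> i j; rewrite /edge_list_rel eq_sym orbC. Qed.

Lemma edge_list_rel_irrefl : irreflexive edge_list_rel.
Proof. by move=> i; rewrite /edge_list_rel eqxx. Qed.

Definition edge_list_graph : sgraph :=
  SGraph edge_list_rel_sym edge_list_rel_irrefl.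
End EdgeList.

Definition claw : sgraph := edge_list_graph 4 [:: (0, 1); (0, 2); (0, 3)].

(** Triangle 0, 1, 2 with a pendant edge at 0, a pendant edge at 1 and the
    pendant path 2, 5, 6. *)
Definition N112 : sgraph :=
  edge_list_graph 7
    [:: (0, 1); (1, 2); (0, 2); (0, 3); (1, 4); (2, 5); (5, 6)].

(** Triangle 0, 1, 2 with the pendant paths 0, 3, 4 and 1, 5, 6. *)
Definition deer : sgraph :=
  edge_list_graph 7
    [:: (0, 1); (1, 2); (0, 2); (0, 3); (3, 4); (1, 5); (5, 6)].

(* Main.v *)
Require Import Defs.
From mathcomp Require Import all_boot zify.
From Stdlib Require Import Lia.

Set Implicit Arguments.
Unset Strict Implicit.
Unset Printing Implicit Defensive.

(** Call x and y joined when they are adjacent or have degree sum at least |G|.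
    By Ore's exchange argument a cycle of joined vertices never exceeds the
    length of a longest cycle c. Suppose that c misses a vertex, and take a
    shortest ear, i.e. a path u R v that meets c in its two ends only. By
    claw-heaviness the two neighbours of u along c are joined; enlarge these three
    vertices to a maximal interval of c whose coverings by one or two paths can
    be prescribed (a "blob"), and do the same at v. Since c is longest, the only
    possible joins between the two blobs are u with v and the respective ends
    facing each other. Hence one of the blobs, say that of u, contains no heavy
    pair of nonadjacent vertices, and as N_{1,1,2} is forbidden its two ends and
    u form a triangle. A count of common neighbours shows that the pair u v, or
    the pair of u and the second vertex of R, is not heavy unless it is an edge;
    then this triangle extends to an induced N_{1,1,2} that is not heavy, or, when
    u v is an edge and R a single vertex, possibly the triangle u v R extends to
    an induced deer that is not heavy. *)

Section Walks.
Variables (T : eqType) (r : rel T).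
Hypothesis r_sym : symmetric r.

Definition walk a b (p : seq T) : bool :=
  if p is x :: q then [&& x == a, path r x q & last x q == b] else false.

Lemma walk1 a : walk a a [:: a].
Proof. by rewrite /walk /= !eqxx. Qed.

Lemma walk_path a p : path r a p -> walk a (last a p) (a :: p).
Proof. by move=> ap; rewrite /walk eqxx ap eqxx. Qed.

Lemma walk_cat a b c d p q :
  walk a b p -> r b c -> walk c d q -> walk a d (p ++ q).
Proof.
case: p => // x p /and3P[/eqP-> xp /eqP lp] bc.
case: q => // y q /and3P[/eqP-> yq /eqP lq].
by rewrite /walk /= eqxx cat_path last_cat lp /= bc yq lq eqxx xp.
Qed.

Lemma walk_cat_path a b p q : walk a b p -> path r b q -> walk a (last b q) (p ++ q).
Proof.
case: p => // x p /and3P[/eqP-> xp /eqP lp] bq.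
by rewrite /walk /= eqxx cat_path last_cat xp lp bq /=.
Qed.

Lemma walk_rcons a b c p : walk a b p -> r b c -> walk a c (rcons p c).
Proof. by rewrite -cats1 => ap bc; apply: walk_cat ap bc (walk1 c). Qed.

Lemma walk_cons a b c p : r c a -> walk a b p -> walk c b (c :: p).
Proof. by move=> ca ap; apply: (walk_cat (walk1 c) ca ap). Qed.

Lemma walk_rev a b p : walk a b p -> walk b a (rev p).
Proof.
case: p => // x p /and3P[/eqP-> ap /eqP <-].
rewrite lastI rev_rcons /walk eqxx rev_path /=; apply/andP; split.
  by rewrite (eq_path (e' := r)) // => u v; apply: r_sym.
by case: p {ap} => [|y p] //=; rewrite rev_cons last_rcons.
Qed.

Lemma walk_cycle a b p : walk a b p -> r b a -> cycle r p.
Proof.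
case: p => // x p /and3P[/eqP-> ap /eqP lp] ba.
by rewrite /= rcons_path ap lp.
Qed.

Lemma walk_mem1 a b p : walk a b p -> a \in p.
Proof. by case: p => // x p /and3P[/eqP-> _ _]; rewrite mem_head. Qed.

Lemma walk_head a b p : walk a b p -> p = a :: behead p.
Proof. by case: p => // x p /and3P[/eqP->]. Qed.

Lemma path_first (P : pred T) x p :
  path r x p -> ~~ P x -> P (last x p) ->
  exists a b, [/\ a \in x :: p, b \in p, r a b, ~~ P a & P b].
Proof.
elim: p x => [|y p IH] x /=; first by move=> _ /negP.
move=> /andP[xy yp] Px Pl; case: (boolP (P y)) => Py.
  by exists x, y; rewrite !mem_head.
have [a [b [ap bp ab Pa Pb]]] := IH _ yp Py Pl.
by exists a, b; rewrite inE ap orbT inE bp orbT.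
Qed.

Lemma shortest_path_induced x y p : path r x p -> last x p = y ->
  exists q, [/\ path r x q, last x q = y, uniq (x :: q), {subset q <= p} &
    forall i j, i < j -> j < size (x :: q) ->
      r (nth x (x :: q) i) (nth x (x :: q) j) -> j = i.+1].
Proof.
have [n] := ubnP (size p); elim: n p => // n IH p sp xp lp.
have shorter q : path r x q -> last x q = y -> size q < size p ->
    {subset q <= p} -> exists q, [/\ path r x q, last x q = y, uniq (x :: q),
    {subset q <= p} & forall i j, i < j -> j < size (x :: q) ->
      r (nth x (x :: q) i) (nth x (x :: q) j) -> j = i.+1].
  move=> xq lq sq sub; have [|q' [? ? ? s' ?]] := IH q _ xq lq; first by lia.
  by exists q'; split=> // z /s' /sub.
case: (boolP (uniq (x :: p))) => Up; last first.
  case: (shortenP xp) lp => p' xp' Up' sub lp'.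
  apply: (shorter p') => //.
  have sub' : {subset x :: p' <= x :: p}.
    by move=> z; rewrite !inE => /orP[->//|/sub->]; rewrite orbT.
  have := uniq_leq_size Up' sub'; rewrite /= ltnS leq_eqVlt => /orP[/eqP E|//].
  by case/negP: Up; apply: (leq_size_uniq Up' sub'); rewrite /= E.
case: (boolP [exists i : 'I_(size (x :: p)), exists j : 'I_(size (x :: p)),
   [&& i < j, r (nth x (x :: p) i) (nth x (x :: p) j) & nat_of_ord j != i.+1]]).
  case/existsP=> -[i li] /existsP[[j lj]] /= /and3P[ij rij nij].
  have dj : drop j.-1 p = nth x (x :: p) j :: drop j p.
    case: j ij lj {rij nij} => // j _ lj /=; exact: drop_nth.
  have li' : last x (take i p) = nth x (x :: p) i.
    case: i {rij nij dj} li ij => [|i] li ij; first by rewrite take0.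
    by rewrite (last_nth x) size_takel // -[_ :: _]/(take i.+2 (x :: p)) nth_take.
  have lj' : last (nth x (x :: p) j) (drop j p) = y.
    by rewrite -lp -[in RHS](cat_take_drop j.-1 p) last_cat dj.
  apply: (shorter (take i p ++ drop j.-1 p)).
  - rewrite cat_path take_path // li' dj /= rij.
    by move: xp; rewrite -{1}(cat_take_drop j.-1 p) cat_path dj => /and3P[].
  - by rewrite last_cat dj /=.
  - by rewrite size_cat size_takel ?size_drop; move: lj li => /=; lia.
  - by move=> z; rewrite mem_cat => /orP[/mem_take|/mem_drop].
rewrite negb_exists => /forallP nv.
exists p; split=> // i j ij js rij.
have is_ : i < size (x :: p) by apply: ltn_trans js.
have := nv (Ordinal is_); rewrite negb_exists => /forallP/(_ (Ordinal js)) /=.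
by rewrite ij rij /= negbK => /eqP.
Qed.

End Walks.

Section Ore.
Variable G : sgraph.
Local Notation adj := (@sedge G).

Definition ore_adj : rel G := fun x y =>
  sedge x y || (#|G| <= degree x + degree y).

Lemma ore_adj_sym : symmetric ore_adj.
Proof. by move=> x y; rewrite /ore_adj sedge_sym addnC. Qed.

Lemma sedge_ore x y : sedge x y -> ore_adj x y.
Proof. by rewrite /ore_adj => ->. Qed.

Lemma crossing (u v : G) x p :
  size p < count (adj u) p + count (adj v) (belast x p) ->
  exists p1 y p2, [/\ p = p1 ++ y :: p2, sedge u y & sedge v (last x p1)].
Proof.
elim: p x => [|y p IH] x //=.
case uy: (sedge u y); case vx: (sedge v x) => /=;
  first by move=> _; exists [::], y, p.
all: move=> H; have [|p1 [z [p2 [-> uz vl]]]] := IH y;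
  first by move: H; rewrite ?add1n ?add0n; lia.
all: by exists (y :: p1), z, p2.
Qed.

Lemma count_setI (P : pred G) (s : seq G) : uniq s ->
  count P s = #|[set x | P x] :&: [set x in s]|.
Proof.
move=> Us; rewrite -size_filter -(card_uniqP (filter_uniq P Us)).
by apply: eq_card => x; rewrite mem_filter !inE.
Qed.

(* A vertex off the path that is adjacent to both ends closes it. If there is
   none, the ends have degree sum at least the size of the path within the path,
   and a crossing as in Ore's theorem closes it. *)
Lemma ore_exchange (r : rel G) u p : symmetric r -> subrel adj r ->
  path r u p -> uniq (u :: p) -> 1 < size p ->
  #|G| <= degree u + degree (last u p) ->
  exists c, [/\ ucycle r c, size p < size c & {subset u :: p <= c}].
Proof.
move=> rsym sub up Up p2 heavy; set v := last u p in heavy *.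
have wp : walk r u v (u :: p) by apply: walk_path.
case: (boolP [exists w, [&& w \notin u :: p, sedge u w & sedge v w]]).
  case/existsP=> w /and3P[wp' uw vw]; exists (w :: u :: p); split=> //; last first.
    by move=> z zp; rewrite inE zp orbT.
  rewrite /ucycle cons_uniq wp' Up !andbT.
  apply: (walk_cycle (a := w) (b := v)); last exact: sub.
  by apply: walk_cons wp; apply: sub; rewrite sedge_sym.
move/existsPn => nw.
have [|p1 [y [p2' [Ep uy vl]]]] := @crossing u v u p.
  set S := [set x in u :: p].
  have cu : count (adj u) p = #|[set y | adj u y] :&: S|.
    by rewrite -count_setI //= sedge_irrefl.
  have cv : count (adj v) (belast u p) = #|[set y | adj v y] :&: S|.
    by rewrite -count_setI // lastI -cats1 count_cat /= sedge_irrefl !addn0.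
  have cS : #|S| = (size p).+1 by rewrite cardsE (card_uniqP Up).
  have : #|([set y | adj u y] :\: S) :|: ([set y | adj v y] :\: S)| <= #|~: S|.
    apply/subset_leq_card/subsetP => x; rewrite !inE.
    by case: (x == u) (x \in p) => [] [] /=; rewrite ?andbF.
  rewrite cardsU (_ : _ :&: _ = set0); last first.
    apply/setP => x; rewrite !inE; apply/negP => /andP[/andP[xs ux] /andP[_ vx]].
    by case/negP: (nw x); rewrite !inE xs ux.
  have := cardsC S; have := cardsID S [set y | adj u y].
  have := cardsID S [set y | adj v y]; move: heavy; rewrite /degree cards0 -cu -cv cS.
  by lia.
exists (u :: p1 ++ rev (y :: p2')); split; last first.
- by move=> z; rewrite Ep !inE !mem_cat mem_rev.
- by rewrite Ep /= !size_cat size_rev.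
rewrite /ucycle; apply/andP; split; last first.
  rewrite (perm_uniq (s2 := u :: p)) // Ep perm_cons perm_cat2l.
  by rewrite perm_rev.
have wyp : walk r y v (y :: p2').
  move: up; rewrite Ep cat_path /= => /and3P[_ _ yp].
  by rewrite /v Ep last_cat; apply: walk_path.
apply: (walk_cycle (a := u) (b := y)); last by apply: sub; rewrite sedge_sym.
rewrite -cat_cons; apply: walk_cat (walk_rev rsym wyp).
  by apply: walk_path; move: up; rewrite Ep cat_path => /andP[].
by apply: sub; rewrite sedge_sym.
Qed.

Lemma rot_to_break (T : eqType) (r : rel T) (c : seq T) : ~~ cycle r c ->
  exists i x p, rot i c = x :: p /\ ~~ r (last x p) x.
Proof.
have brk x p : ~~ path r x p ->
    exists p1 y p2, p = p1 ++ y :: p2 /\ ~~ r (last x p1) y.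
  elim: p x => //= y p IH x; rewrite negb_and => /orP[xy|/IH].
    by exists [::], y, p.
  by case=> p1 [z [p2 [-> H]]]; exists (y :: p1), z, p2.
case: c => // x p /= /brk[p1 [y [p2]]].
case/lastP: p2 => [|p2 z] [].
  by rewrite cats1 => /rcons_inj[<- <-] H; exists 0, x, p; rewrite rot0.
rewrite -rcons_cons -rcons_cat => /rcons_inj[-> _] H.
exists (size (x :: p1)), y, (p2 ++ x :: p1); split; last by rewrite last_cat.
by rewrite -cat_cons rot_size_cat.
Qed.

Lemma ore_cover c : ucycle ore_adj c -> 2 < size c ->
  exists c', [/\ ucycle adj c', size c <= size c' & {subset c <= c'}].
Proof.
pose ext (s : seq (G * G)) : rel G :=
  fun x y => adj x y || ((x, y) \in s) || ((y, x) \in s).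
have ext_sym s : symmetric (ext s).
  by move=> x y; rewrite /ext sedge_sym -!orbA [X in _ || X]orbC.
pose hs := [seq q <- enum ({: G * G}) | #|G| <= degree q.1 + degree q.2].
have hext x y : ore_adj x y -> ext hs x y.
  move=> /orP[xy|xy]; rewrite /ext ?xy //.
  by rewrite mem_filter /= xy mem_enum orbT.
have hsP : all (fun q => #|G| <= degree q.1 + degree q.2) hs.
  by apply/allP => q; rewrite mem_filter => /andP[].
move=> /andP[cc Uc] sc.
have {cc hext} : ucycle (ext hs) c.
  by rewrite /ucycle Uc andbT; apply: sub_cycle cc.
elim: hs c Uc sc hsP => [|[u v] s IH] c Uc sc /=.
  move=> _ cc; exists c; split=> //; move: cc; rewrite /ucycle => /andP[cc ->].
  by rewrite andbT; apply: sub_cycle cc => x y; rewrite /ext !orbF.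
move=> /andP[huv hs] /andP[cc _].
case: (boolP (cycle (ext s) c)) => [cs|]; first by apply: IH; rewrite // /ucycle cs.
case/rot_to_break => i [x [p [Ei nx]]].
have Uxp : uniq (x :: p) by rewrite -Ei rot_uniq.
have sxp : size (x :: p) = size c by rewrite -Ei size_rot.
have exE a b : ext ((u, v) :: s) a b -> ext s a b \/ (a, b) = (u, v) \/ (b, a) = (u, v).
  by rewrite /ext !inE -!orbA => /or4P[->|/eqP->|->|/orP[/eqP->|->]]; rewrite ?orbT; auto.
have : cycle (ext ((u, v) :: s)) (x :: p) by rewrite -Ei rot_cycle.
rewrite /= rcons_path => /andP[xp lx].
have [c' [uc' sc' sub']] : exists c', [/\ ucycle (ext s) c', size p < size c'
    & {subset x :: p <= c'}].
  apply: ore_exchange => //; first by move=> a b ab; rewrite /ext ab.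
  - have uvE : (u, v) = (last x p, x) \/ (u, v) = (x, last x p).
      by case: (exE _ _ lx) => [|[]E]; [rewrite (negPf nx)|left|right].
    have xuv : x \in [:: u; v] by case: uvE => -[-> ->]; rewrite !inE eqxx ?orbT.
    move: xp Uxp sxp sc uvE; case: (p) => [|y p'] /=; first by move=> _ _ <-.
    move=> /andP[xy yp] /and3P[xyp yp' Up] sxp sc uvE; apply/andP; split.
      case: (exE _ _ xy) => // H; exfalso.
      have yl : y = last y p'.
        by case: H uvE => -[<- <-] [] [] *; subst.
      by case: p' yl yp' sxp {yp xyp Up uvE} => [|z p'] /= yl;
        rewrite ?yl ?mem_last // => _ sxp; move: sc; rewrite -sxp.
    apply: (@sub_in_path _ (predC1 x)) yp.
      move=> a b /= ax bx; case/exE => // -[] E; move: xuv ax bx;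
      by case: E => <- <-; rewrite !inE ![x == _]eq_sym => /orP[->|->] //.
    by apply/allP => z zp /=; apply: contraNneq xyp => <-.
  - by move: sc; rewrite -sxp /=; lia.
  by have := exE _ _ lx; case=> [H|[] [-> ->]]; rewrite ?H // in nx *; rewrite addnC.
have [||c'' [uc'' sc'' sub'']] := IH c' _ _ hs uc'.
- by case/andP: uc'.
- by move: sc sc'; rewrite -sxp /=; lia.
exists c''; split=> //; first by rewrite -sxp; apply: leq_trans sc''.
by move=> z zc; apply/sub''/sub'; rewrite -Ei mem_rot.
Qed.

End Ore.

Section Forbidden.
Variable G : sgraph.
Local Notation adj := (@sedge G).
Local Notation ore := (@ore_adj G).

Lemma heavy_copy (H : sgraph) (f : H -> G) : graph_heavy H G -> injective f ->
  (forall x y, sedge (f x) (f y) = sedge x y) ->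
  exists x y : H, [/\ x != y, ~~ sedge x y & #|G| <= degree (f x) + degree (f y)].
Proof.
move=> hH injf fE; pose A := f @: [set: H].
have fA x : f x \in A by apply: imset_f.
pose g (x : H) : induced A := exist _ (f x) (fA x).
have injg : injective g by move=> x y [] /injf.
have [|g' g'K gK'] := inj_card_bij injg.
  by rewrite card_sig -(cardsT H) -(card_imset _ injf); apply: eq_leq; apply: eq_card.
have [] := hH A.
  exists g'; first by exists g.
  by move=> x y; rewrite -fE -{2}(gK' x) -{2}(gK' y).
move=> _ [_ [/imsetP[x _ ->] /imsetP[y _ ->] xy nxy hxy]].
exists x, y; split=> //; last by rewrite -fE.
by apply: contraNneq xy => ->.
Qed.

(* The hypothesis on [nb] says that the pattern has no twins, so that a map
   preserving adjacency and non-adjacency is injective. *)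
Lemma no_copy n es (s : seq G) x0 : graph_heavy (edge_list_graph n es) G ->
  let nb i := [seq k <- iota 0 n | (i != k) && (((i, k) \in es) || ((k, i) \in es))] in
  uniq [seq nb i | i <- iota 0 n] ->
  (forall i j, i < j -> j < n -> if ((i, j) \in es) || ((j, i) \in es)
     then adj (nth x0 s i) (nth x0 s j) else ~~ ore (nth x0 s i) (nth x0 s j)) ->
  False.
Proof.
move=> hH nb tw ed; pose f (i : edge_list_graph n es) := nth x0 s (nat_of_ord i).
have fE x y : sedge (f x) (f y) = sedge x y.
  rewrite /= /edge_list_rel; case: (ltngtP x y) => [xy|yx|/val_inj->].
  - have := ed _ _ xy (ltn_ord y); rewrite (_ : x != y) ?neq_ltn ?xy //.
    by case: (_ || _) => //; rewrite negb_or => /andP[/negPf-> _].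
  - rewrite (_ : x != y) ?neq_ltn ?yx ?orbT // sedge_sym orbC.
    have := ed _ _ yx (ltn_ord x).
    by case: (_ || _) => //; rewrite negb_or => /andP[/negPf-> _].
  - by rewrite sedge_irrefl eqxx.
have [|x [y [xy nxy hxy]]] := heavy_copy (f := f) hH _ fE.
  move=> x y fxy; apply/val_inj/eqP.
  rewrite -(nth_uniq [::] _ _ tw) ?size_map ?size_iota ?ltn_ord //.
  rewrite !(nth_map 0) ?size_iota ?ltn_ord // !nth_iota ?ltn_ord // !add0n.
  apply/eqP/eq_in_filter => k; rewrite mem_iota add0n => /andP[_ kn].
  by have := fE x (Ordinal kn); rewrite fxy fE => /esym.
wlog lxy : x y xy nxy hxy / x < y.
  move: (xy); rewrite neq_ltn => /orP[lt|lt] W; first exact: W lt.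
  by apply: (W y x) => //; rewrite 1?eq_sym 1?sedge_sym // addnC.
have := ed _ _ lxy (ltn_ord y).
move: nxy; rewrite /= /edge_list_rel xy /= => /negPf->.
by rewrite /ore_adj hxy orbT.
Qed.

Hypothesis claw_heavy : graph_heavy claw G.

Lemma claw_ore x a b c : sedge x a -> sedge x b -> sedge x c ->
  a != b -> a != c -> b != c -> [\/ ore a b, ore a c | ore b c].
Proof.
move=> xa xb xc ab ac bc.
case: (boolP (ore a b)) => nab; first by constructor 1.
case: (boolP (ore a c)) => nac; first by constructor 2.
case: (boolP (ore b c)) => nbc; first by constructor 3.
pose f (i : claw) := nth x [:: x; a; b; c] (nat_of_ord i).
have nadj y z : ~~ ore y z -> sedge y z = false.
  by rewrite negb_or => /andP[/negPf].
have neq y z : sedge y z -> y != z.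
  by apply: contraTneq => ->; rewrite sedge_irrefl.
have sy y z : sedge y z = true -> sedge z y by rewrite sedge_sym.
have [||i [j [dij nij hd]]] := @heavy_copy claw f claw_heavy.
- have Us : uniq [:: x; a; b; c] by rewrite /= !inE !negb_or ab ac bc !neq.
  by move=> i j /eqP; rewrite /f nth_uniq // => /eqP/val_inj.
- case=> [[|[|[|[|i]]]] li] [[|[|[|[|j]]]] lj] //; rewrite /f /= ?sedge_irrefl //;
  by do ?[exact: sy | exact: nadj | rewrite sedge_sym; exact: nadj].
have {hd}: ore (f i) (f j) by rewrite /ore_adj hd orbT.
case: i j dij nij => [[|[|[|[|i]]]] li] [[|[|[|[|j]]]] lj] //= _ _; rewrite /f /= => hd;
by first [rewrite hd in nab | rewrite hd in nac | rewrite hd in nbc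
         | rewrite ore_adj_sym hd in nab | rewrite ore_adj_sym hd in nac
         | rewrite ore_adj_sym hd in nbc].
Qed.

Hypothesis N112_heavy : graph_heavy N112 G.
Hypothesis deer_heavy : graph_heavy deer G.

Lemma N112_ore a b c a1 b1 c1 c2 :
  [/\ sedge a b, sedge b c & sedge a c] ->
  [/\ sedge a a1, sedge b b1, sedge c c1 & sedge c1 c2] ->
  [/\ ~~ ore a b1, ~~ ore a c1, ~~ ore a c2, ~~ ore b a1 & ~~ ore b c1] ->
  [/\ ~~ ore b c2, ~~ ore c a1, ~~ ore c b1, ~~ ore c c2 & ~~ ore a1 b1] ->
  [/\ ~~ ore a1 c1, ~~ ore a1 c2, ~~ ore b1 c1 & ~~ ore b1 c2] -> False.
Proof.
move=> [ab bc ac] [aa1 bb1 cc1 cc2] [? ? ? ? ?] [? ? ? ? ?] [? ? ? ?].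
apply: (@no_copy _ _ [:: a; b; c; a1; b1; c1; c2] a N112_heavy).
  by [].
by case=> [|[|[|[|[|[|[|?]]]]]]] [|[|[|[|[|[|[|?]]]]]]] //= _ _; rewrite // ore_adj_sym.
Qed.

Lemma deer_ore a b c a1 a2 b1 b2 :
  [/\ sedge a b, sedge b c & sedge a c] ->
  [/\ sedge a a1, sedge a1 a2, sedge b b1 & sedge b1 b2] ->
  [/\ ~~ ore a a2, ~~ ore a b1, ~~ ore a b2, ~~ ore b a1 & ~~ ore b a2] ->
  [/\ ~~ ore b b2, ~~ ore c a1, ~~ ore c a2, ~~ ore c b1 & ~~ ore c b2] ->
  [/\ ~~ ore a1 b1, ~~ ore a1 b2, ~~ ore a2 b1 & ~~ ore a2 b2] -> False.
Proof.
move=> [ab bc ac] [aa1 aa2 bb1 bb2] [? ? ? ? ?] [? ? ? ? ?] [? ? ? ?].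
apply: (@no_copy _ _ [:: a; b; c; a1; a2; b1; b2] a deer_heavy); first by [].
by case=> [|[|[|[|[|[|[|?]]]]]]] [|[|[|[|[|[|[|?]]]]]]] //= _ _; rewrite // ore_adj_sym.
Qed.

End Forbidden.

Ltac perm_count :=
  let P := fresh in apply/permP => P;
  repeat match goal with H : is_true (perm_eq _ _) |- _ =>
    move: (permP H P) => {H} end;
  rewrite -?cats1; repeat progress rewrite ?(count_cat, count_rev) /=; clear;
  repeat match goal with |- context [count ?a ?s] =>
    let m := fresh in move: (count a s) => m end;
  repeat match goal with |- context [nat_of_bool ?a] =>
    let m := fresh in move: (nat_of_bool a) => m end; clear; lia.

Section Blobs.
Variables (T : eqType) (r : rel T).
Hypothesis r_sym : symmetric r.
Implicit Types (a c d s u x y : T) (p q X : seq T).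

Definition cov1 a b X := exists2 p, walk r a b p & perm_eq p X.
Definition cov2 a b c d X :=
  exists p q, [/\ walk r a b p, walk r c d q & perm_eq (p ++ q) X].

Lemma cov1_perm a b X Y : perm_eq X Y -> cov1 a b X -> cov1 a b Y.
Proof. by move=> XY [p ? pX]; exists p => //; apply: perm_trans XY. Qed.

Lemma cov2_perm a b c d X Y : perm_eq X Y -> cov2 a b c d X -> cov2 a b c d Y.
Proof. by move=> XY [p [q [? ? pX]]]; exists p, q; split=> //; apply: perm_trans XY. Qed.

Lemma cov1_rev a b X : cov1 a b X -> cov1 b a X.
Proof.
move=> [p wp pX]; exists (rev p); first exact: walk_rev.
by rewrite perm_rev.
Qed.

(* [blob u f b] describes an interval of a cycle around u, whose two arms,
   listed from the outermost vertex inwards, are f and b. *)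
Inductive blob u : seq T -> seq T -> Prop :=
| blob_base x y : r u x -> r u y -> r x y -> blob u [:: x] [:: y]
| blob_left x a f b s : blob u (a :: f) b -> r a x -> s \in u :: f ++ b ->
    r x s -> blob u (x :: a :: f) b
| blob_right y f c b s : blob u f (c :: b) -> r c y -> s \in u :: f ++ b ->
    r y s -> blob u f (y :: c :: b)
| blob_both x y a f c b : blob u (a :: f) (c :: b) -> r a x -> r c y -> r x y ->
    blob u (x :: a :: f) (y :: c :: b).

Lemma blob_sym u f b : blob u f b -> blob u b f.
Proof.
elim=> {f b}.
- by move=> x y ux uy xy; apply: blob_base => //; rewrite r_sym.
- move=> x a f b s _ H ax sI xs; apply: (blob_right (s := s)) => //.
  by move: sI; rewrite !inE !mem_cat [X in _ || X]orbC.
- move=> x a f b s _ H ax sI xs; apply: (blob_left (s := s)) => //.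
  by move: sI; rewrite !inE !mem_cat [X in _ || X]orbC.
- by move=> x y a f c b _ H ax cy xy; apply: blob_both; rewrite // r_sym.
Qed.

Lemma blob_arms u f b : blob u f b -> f = head u f :: behead f /\ b = head u b :: behead b.
Proof. by elim=> {f b} // => [? ? ? ? ? _ []|? ? ? ? ? _ []]. Qed.

Definition blob_half u f b := let X := u :: f ++ b in
  [/\ cov1 u (head u f) X,
      forall s, s \in u :: behead f ++ b ->
        cov2 u (head u f) s (head u b) X \/ cov2 u s (head u f) (head u b) X
    & forall s, s \in b -> cov2 u (head u f) s (head u b) X].

Lemma cov2_app2 a b c d e X : r d e -> cov2 a b c d X -> cov2 a b c e (e :: X).
Proof.
move=> de [p [q [wp wq pq]]]; exists p, (rcons q e); split=> //.
  exact: walk_rcons wq de.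
by perm_count.
Qed.

Lemma cov2_app1 a b c d e X : r b e -> cov2 a b c d X -> cov2 a e c d (e :: X).
Proof.
move=> be [p [q [wp wq pq]]]; exists (rcons p e), q; split=> //.
  exact: walk_rcons wp be.
by perm_count.
Qed.

Lemma cov2_cons2 a b c d e X : r e c -> cov2 a b c d X -> cov2 a b e d (e :: X).
Proof.
move=> de [p [q [wp wq pq]]]; exists p, (e :: q); split=> //.
  exact: walk_cons wq.
by perm_count.
Qed.

Lemma cov1_app a b e X : r b e -> cov1 a b X -> cov1 a e (e :: X).
Proof.
move=> be [p wp pX]; exists (rcons p e); first exact: walk_rcons wp be.
by perm_count.
Qed.

Lemma cov2_join a b c d X : r b c -> cov2 a b c d X -> cov1 a d X.
Proof. by move=> bc [p [q [wp wq pq]]]; exists (p ++ q) => //; exact: walk_cat wp bc wq. Qed.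

Lemma cov2_single a b e X : cov1 a b X -> cov2 a b e e (e :: X).
Proof.
move=> [p wp pX]; exists p, [:: e]; split=> //; first exact: walk1.
by perm_count.
Qed.

Lemma half_left u x a f b s : r a x -> s \in u :: f ++ b -> r x s ->
  blob_half u (a :: f) b -> blob_half u b (a :: f) ->
  blob_half u (x :: a :: f) b /\ blob_half u b (x :: a :: f).
Proof.
move=> ax sI xs [/= H Q A] [/= H' Q' A'].
have pm : perm_eq (x :: u :: (a :: f) ++ b) (u :: (x :: a :: f) ++ b) by perm_count.
have pm' : perm_eq (x :: u :: b ++ a :: f) (u :: b ++ x :: a :: f) by perm_count.
have pm2 : perm_eq (x :: u :: (a :: f) ++ b) (u :: b ++ x :: a :: f) by perm_count.
split; split=> /=.
- by apply: cov1_perm pm _; apply: cov1_app H.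
- move=> t; rewrite !inE orbCA -in_cons => /orP[/eqP->|tI].
    case: (Q s sI) => c2; [right|left]; apply: cov2_perm pm _.
      exact: cov2_cons2 xs c2.
    by apply: cov2_app1 c2; rewrite r_sym.
  case: (Q t tI) => c2; [left|right]; apply: cov2_perm pm _.
    exact: cov2_app1 c2.
  by apply: cov2_cons2 c2; rewrite r_sym.
- by move=> t /A c2; apply: cov2_perm pm _; apply: cov2_app1 c2.
- apply: cov1_perm pm2 _; case: (Q s sI) => c2.
    exact: cov2_join xs (cov2_app1 ax c2).
  by apply: (cov2_join (b := x)) (cov2_app1 _ c2); rewrite r_sym.
- move=> t tI; have [->|nx] := eqVneq t x.
    by left; apply: cov2_perm pm' _; apply: cov2_single.
  have : t \in u :: behead b ++ a :: f.
    by move: tI; rewrite !(inE, mem_cat) (negPf nx).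
  by case/Q' => c2; [left|right]; apply: cov2_perm pm' _; apply: cov2_app2 c2.
- move=> t; rewrite inE => /orP[/eqP->|/A' c2]; apply: cov2_perm pm' _.
    exact: cov2_single.
  exact: cov2_app2 c2.
Qed.

Lemma half_both u x y a f c b : r a x -> r c y -> r x y ->
  blob_half u (a :: f) (c :: b) -> blob_half u (c :: b) (a :: f) ->
  blob_half u (x :: a :: f) (y :: c :: b).
Proof.
move=> ax cy xy [/= H Q A] [/= H' Q' A'].
have pm : perm_eq (y :: x :: u :: (a :: f) ++ (c :: b)) (u :: (x :: a :: f) ++ (y :: c :: b)) by perm_count.
have pm' : perm_eq (x :: y :: u :: (c :: b) ++ a :: f) (u :: (x :: a :: f) ++ (y :: c :: b)) by perm_count.
split=> /=.
- by apply: cov1_perm pm' _; apply: cov1_app (cov1_app cy H'); rewrite r_sym.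
- move=> t tI.
  have : [\/ t = y, t = a | t \in u :: f ++ c :: b].
    have [|ny] := eqVneq t y; first by constructor 1.
    have [|na] := eqVneq t a; first by constructor 2.
    by constructor 3; move: tI; rewrite !(inE, mem_cat) (negPf ny) (negPf na).
  case=> [->|->|/Q[] c2].
  + by left; apply: cov2_perm pm _; apply: cov2_single (cov1_app ax H).
  + right; apply: cov2_perm pm _; apply: cov2_app2 xy _.
    exact: cov2_single.
  + by left; apply: cov2_perm pm _; apply: cov2_app2 cy _; apply: cov2_app1 c2.
  + right; apply: cov2_perm pm _; apply: cov2_app2 cy _.
    by apply: cov2_cons2 c2; rewrite r_sym.
- move=> t; rewrite inE => /orP[/eqP->|/A c2]; apply: cov2_perm pm _.
    exact: cov2_single (cov1_app ax H).
  by apply: cov2_app2 cy _; apply: cov2_app1 c2.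
Qed.

Lemma blob_covers u f b : blob u f b -> blob_half u f b /\ blob_half u b f.
Proof.
elim=> {f b}.
- have base x y : r u x -> r u y -> r x y -> blob_half u [:: x] [:: y].
    move=> ux uy xy; split=> /=.
    + exists [:: u; y; x]; last by perm_count.
      by rewrite /walk /= !eqxx uy r_sym xy.
    + move=> s; rewrite !inE => /orP[] /eqP->.
        by right; exists [:: u], [:: x; y]; rewrite /walk /= !eqxx xy perm_refl.
      by left; exists [:: u; x], [:: y]; rewrite /walk /= !eqxx ux perm_refl.
    + move=> s; rewrite !inE => /eqP->.
      by exists [:: u; x], [:: y]; rewrite /walk /= !eqxx ux perm_refl.
  by move=> x y ux uy xy; split; apply: base; rewrite // r_sym.
- by move=> x a f b s _ [H1 H2] ax sI xs; apply: half_left xs H1 H2.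
- move=> y f c b s _ [H1 H2] cy sI ys.
  have [|? ?] := half_left cy _ ys H2 H1; last by split.
  by move: sI; rewrite !inE !mem_cat [X in _ || X]orbC.
- move=> x y a f c b _ [H1 H2] ax cy xy; split; first exact: half_both.
  by apply: half_both => //; rewrite r_sym.
Qed.

Lemma blob_straight u f b : blob u f b ->
  cov1 (head u b) (head u f) (u :: f ++ b) /\ cov1 (head u b) (head u f) (f ++ b).
Proof.
elim=> {f b} /=.
- move=> x y ux uy xy; split; [exists [:: y; u; x]|exists [:: y; x]].
  + by rewrite /walk /= !eqxx r_sym uy ux.
  + by perm_count.
  + by rewrite /walk /= !eqxx r_sym xy.
  + by perm_count.
- move=> x a f b s _ [H1 H2] ax _ _; split.
    by apply: cov1_perm (cov1_app ax H1); perm_count.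
  by apply: cov1_perm (cov1_app ax H2); perm_count.
- move=> y f c b s _ [/cov1_rev H1 /cov1_rev H2] cy _ _; split; apply: cov1_rev.
    by apply: cov1_perm (cov1_app cy H1); perm_count.
  by apply: cov1_perm (cov1_app cy H2); perm_count.
- move=> x y a f c b _ [H1 H2] ax cy _; split.
    have /cov1_rev H := cov1_app ax H1.
    by apply: cov1_perm (cov1_rev (cov1_app cy H)); perm_count.
  have /cov1_rev H := cov1_app ax H2.
  by apply: cov1_perm (cov1_rev (cov1_app cy H)); perm_count.
Qed.

End Blobs.

Section TwoBlobs.
Variables (T : eqType) (r : rel T).
Hypothesis r_sym : symmetric r.

(* A cycle u f S1 g v h S2 b through two blobs (arms listed inwards), the
   connecting paths S1 and S2 being oriented from the blob of u to the blob of v,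
   and a path Q outside the cycle that starts next to u. No cycle covers all. *)
Record conf u f b v g h (x1 y1 : T) S1 (x2 y2 : T) S2 (z z' : T) Q : Prop := Conf {
  cf_u : blob r u f b;
  cf_v : blob r v g h;
  cf_S1 : [/\ walk r x1 y1 S1, r (head u f) x1 & r y1 (head v g)];
  cf_S2 : [/\ walk r x2 y2 S2, r (head u b) x2 & r y2 (head v h)];
  cf_Q : walk r z z' Q /\ r u z;
  cf_long : forall p a c, walk r a c p -> r c a ->
    perm_eq p ((u :: f ++ b) ++ (v :: g ++ h) ++ S1 ++ S2 ++ Q) -> False }.

Lemma conf_mirror u f b v g h x1 y1 S1 x2 y2 S2 z z' Q :
  conf u f b v g h x1 y1 S1 x2 y2 S2 z z' Q ->
  conf u b f v h g x2 y2 S2 x1 y1 S1 z z' Q.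
Proof.
move=> [cu cv cS1 cS2 cQ cl]; split=> //; try exact: blob_sym.
move=> p a c wp ca pp; apply: cl wp ca _; perm_count.
Qed.

Lemma conf_swap u f b v g h x1 y1 S1 x2 y2 S2 z z' Q :
  r z' v -> conf u f b v g h x1 y1 S1 x2 y2 S2 z z' Q ->
  conf v g h u f b y1 x1 (rev S1) y2 x2 (rev S2) z' z (rev Q).
Proof.
move=> zv [cu cv [? ? ?] [? ? ?] [? ?] cl]; split=> //.
- by split; rewrite 1?r_sym //; apply: walk_rev.
- by split; rewrite 1?r_sym //; apply: walk_rev.
- by split; rewrite 1?r_sym //; apply: walk_rev.
move=> p a c wp ca pp; apply: cl wp ca _; perm_count.
Qed.

Section Claims.
Variables (u v x1 y1 x2 y2 z z' : T) (f b g h S1 S2 Q : seq T).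
Hypothesis cf : conf u f b v g h x1 y1 S1 x2 y2 S2 z z' Q.

Lemma off_cycle_left s : s \in f -> r z' s -> False.
Proof.
case: cf => cu cv [wS1 Lx1 yg] [wS2 Kx2 yh] [wQ uz] cl sf zs.
have [_ [_ _ A']] := blob_covers r_sym cu.
have [p [q [wp wq pq]]] := A' _ sf.
have [[j wj pj] _] := blob_straight r_sym (blob_sym r_sym cv).
have w1 := walk_cat (walk_cat wq Lx1 wS1) yg wj.
have hy : r (head v h) y2 by rewrite r_sym.
have xK : r x2 (head u b) by rewrite r_sym.
have w2 := walk_cat (walk_cat w1 hy (walk_rev r_sym wS2)) xK (walk_rev r_sym wp).
by apply: cl (walk_cat w2 uz wQ) zs _; perm_count.
Qed.

Lemma off_cycle_x1 : r z' x1 -> False.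
Proof.
case: cf => cu cv [wS1 Lx1 yg] [wS2 Kx2 yh] [wQ uz] cl zx.
have [_ [[p wp pp] _ _]] := blob_covers r_sym cu.
have [[j wj pj] _] := blob_straight r_sym (blob_sym r_sym cv).
have w1 := walk_cat (walk_cat (walk_rev r_sym wp) uz wQ) zx wS1.
have hy : r (head v h) y2 by rewrite r_sym.
have xK : r x2 (head u b) by rewrite r_sym.
have w2 := walk_cat (walk_cat w1 yg wj) hy (walk_rev r_sym wS2).
by apply: cl w2 xK _; perm_count.
Qed.

Hypothesis zv : r z' v.

Lemma v_left s : s \in f -> r v s -> False.
Proof.
case: cf => cu cv [wS1 Lx1 yg] [wS2 Kx2 yh] [wQ uz] cl sf vs.
have [_ [_ _ A']] := blob_covers r_sym cu.
have [p [q [wp wq pq]]] := A' _ sf.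
have [_ [j wj pj]] := blob_straight r_sym (blob_sym r_sym cv).
have w1 := walk_cat (walk_cat wq Lx1 wS1) yg wj.
have hy : r (head v h) y2 by rewrite r_sym.
have xK : r x2 (head u b) by rewrite r_sym.
have w2 := walk_cat (walk_cat w1 hy (walk_rev r_sym wS2)) xK (walk_rev r_sym wp).
by apply: cl (walk_rcons (walk_cat w2 uz wQ) zv) vs _; perm_count.
Qed.

Lemma v_x1 : r v x1 -> False.
Proof.
case: cf => cu cv [wS1 Lx1 yg] [wS2 Kx2 yh] [wQ uz] cl vx.
have [_ [[p wp pp] _ _]] := blob_covers r_sym cu.
have [_ [j wj pj]] := blob_straight r_sym (blob_sym r_sym cv).
have w1 := walk_cat (walk_rcons (walk_cat (walk_rev r_sym wp) uz wQ) zv) vx wS1.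
have hy : r (head v h) y2 by rewrite r_sym.
have xK : r x2 (head u b) by rewrite r_sym.
have w2 := walk_cat (walk_cat w1 yg wj) hy (walk_rev r_sym wS2).
by apply: cl w2 xK _; perm_count.
Qed.

Lemma x1_blob t : t \in v :: behead g ++ h -> r x1 t -> False.
Proof.
case: cf => cu cv [wS1 Lx1 yg] [wS2 Kx2 yh] [wQ uz] cl tJ xt.
have [_ [[p wp pp] _ _]] := blob_covers r_sym cu.
have [[_ Qv _] _] := blob_covers r_sym cv.
have hy : r (head v h) y2 by rewrite r_sym.
have xK : r x2 (head u b) by rewrite r_sym.
have gy : r (head v g) y1 by rewrite r_sym.
have tx : r t x1 by rewrite r_sym.
have w1 := walk_cat (walk_rev r_sym wp) uz wQ.
case: (Qv _ tJ) => -[p1 [p2 [w2 w3 p12]]].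
  have w4 := walk_cat (walk_cat (walk_cat w1 zv w2) gy (walk_rev r_sym wS1)) xt w3.
  by apply: cl (walk_cat w4 hy (walk_rev r_sym wS2)) xK _; perm_count.
have w4 := walk_cat (walk_cat (walk_cat w1 zv w2) tx wS1) yg w3.
by apply: cl (walk_cat w4 hy (walk_rev r_sym wS2)) xK _; perm_count.
Qed.

Lemma x1_y2 : r x1 y2 -> False.
Proof.
case: cf => cu cv [wS1 Lx1 yg] [wS2 Kx2 yh] [wQ uz] cl xy.
have [_ [[p wp pp] _ _]] := blob_covers r_sym cu.
have [[[j wj pj] _ _] _] := blob_covers r_sym cv.
have xK : r x2 (head u b) by rewrite r_sym.
have gy : r (head v g) y1 by rewrite r_sym.
have w1 := walk_cat (walk_cat (walk_rev r_sym wp) uz wQ) zv wj.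
have w2 := walk_cat (walk_cat w1 gy (walk_rev r_sym wS1)) xy (walk_rev r_sym wS2).
by apply: cl w2 xK _; perm_count.
Qed.

Lemma cross_away s t : s \in b -> t \in v :: g ++ behead h -> r s t -> False.
Proof.
case: cf => cu cv [wS1 Lx1 yg] [wS2 Kx2 yh] [wQ uz] cl sb tJ st.
have [[_ _ A] _] := blob_covers r_sym cu.
have [_ [_ Qv _]] := blob_covers r_sym cv.
have hy : r (head v h) y2 by rewrite r_sym.
have gy : r (head v g) y1 by rewrite r_sym.
have vz : r v z' by rewrite r_sym.
have zu : r z u by rewrite r_sym.
have ts : r t s by rewrite r_sym.
have [p [q [wp wq pq]]] := A _ sb.
have tJ' : t \in v :: behead h ++ g.
  by move: tJ; rewrite !inE !mem_cat [X in _ || X]orbC.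
have wuS := walk_cat wp Lx1 wS1.
have wQr := walk_rev r_sym wQ.
case: (Qv _ tJ') => -[p1 [p2 [w1 w2 p12]]].
  have w3 := walk_cat (walk_cat wuS yg (walk_rev r_sym w2)) ts wq.
  have w4 := walk_cat (walk_cat (walk_cat w3 Kx2 wS2) yh (walk_rev r_sym w1)) vz wQr.
  by apply: cl w4 zu _; perm_count.
have w3 := walk_cat (walk_cat (walk_cat wuS yg (walk_rev r_sym w2)) hy (walk_rev r_sym wS2)).
have xK : r x2 (head u b) by rewrite r_sym.
have w4 := walk_cat (walk_cat (w3 _ _ _ xK (walk_rev r_sym wq)) st (walk_rev r_sym w1)) vz wQr.
by apply: cl w4 zu _; perm_count.
Qed.

End Claims.

Lemma cross u f b v g h x1 y1 S1 x2 y2 S2 z z' Q s t :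
  conf u f b v g h x1 y1 S1 x2 y2 S2 z z' Q -> r z' v ->
  s \in u :: f ++ b -> t \in v :: g ++ h -> r s t ->
  [\/ s = u /\ t = v, s = head u f /\ t = head v g | s = head u b /\ t = head v h].
Proof.
move=> cf zv sI tJ st.
have ts : r t s by rewrite r_sym.
have zu : r z u by rewrite r_sym; case: cf => _ _ _ _ [].
have cfm := conf_mirror cf.
have cfs := conf_swap zv cf.
have cfms := conf_swap zv cfm.
have [Ef Eb] := blob_arms (cf_u cf); have [Eg Eh] := blob_arms (cf_v cf).
move: sI; rewrite inE mem_cat => /or3P[/eqP sE|sf|sb].
- subst s; move: tJ; rewrite inE mem_cat => /or3P[/eqP->|tg|th]; first by constructor 1.
    by case: (v_left cfs zu tg).
  by case: (v_left cfms zu th).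
- move: (tJ); rewrite Eg cat_cons !inE orbCA => /orP[/eqP tE|tJ']; last first.
    case: (cross_away cfm zv sf _ st).
    by move: tJ'; rewrite !inE !mem_cat [X in _ || X]orbC.
  move: (sf); rewrite Ef inE => /orP[/eqP->|sf']; first by constructor 2.
  case: (cross_away cfms zu _ _ ts); first by rewrite Eg tE mem_head.
  by rewrite inE mem_cat sf' !orbT.
- move: (tJ); rewrite Eh inE mem_cat inE orbA orbCA => /orP[/eqP tE|tJ']; last first.
    by case: (cross_away cf zv sb _ st); rewrite inE mem_cat orbA.
  move: (sb); rewrite Eb inE => /orP[/eqP->|sb']; first by constructor 3.
  case: (cross_away cfs zu _ _ ts); first by rewrite Eh tE mem_head.
  by rewrite inE mem_cat sb' !orbT.
Qed.

End TwoBlobs.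

(* [lia] with only the order facts about [nat] in the context. *)
Ltac arith :=
  repeat match goal with H : ?P |- _ =>
    lazymatch P with
    | is_true (_ <= _) => fail
    | is_true ((_ <= _) && (_ <= _)) => fail
    | @eq ?T _ _ => tryif unify T nat then fail else clear H
    | _ => lazymatch type of P with Prop => clear H end
    end end;
  repeat match goal with H : ?P |- _ =>
    lazymatch type of P with Prop => move: H end end;
  repeat match goal with
  | |- context [@size ?T ?s] => let m := fresh in set m := (@size T s); clearbody m
  | |- context [@count ?T ?a ?s] => let m := fresh in set m := (@count T a s); clearbody m
  end; lia.

Section Ports.
Variable G : sgraph.
Local Notation adj := (@sedge G).
Local Notation ore := (@ore_adj G).
Hypothesis claw_heavy : graph_heavy claw G.
Hypothesis N112_heavy : graph_heavy N112 G.

(* Three ports p_i of a connected set W, each with a private neighbour q_i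
   outside. A shortest path from p1 to p2, prolonged by q1 and q2, together
   with the place where the third port gets attached to it would contain an
   induced N112 if it had an interior vertex. *)
Lemma ports_adj (W : seq G) p1 p2 p3 q1 q2 q3 :
  [/\ p1 \in W, p2 \in W & p3 \in W] -> [/\ q1 \notin W, q2 \notin W & q3 \notin W] ->
  [/\ p1 != p2, p1 != p3 & p2 != p3] ->
  [/\ adj p1 q1, adj p2 q2 & adj p3 q3] ->
  [/\ ~~ ore q1 q2, ~~ ore q1 q3 & ~~ ore q2 q3] ->
  (forall w, w \in W -> w != p1 -> ~~ ore q1 w) ->
  (forall w, w \in W -> w != p2 -> ~~ ore q2 w) ->
  (forall w, w \in W -> w != p3 -> ~~ ore q3 w) ->
  {in W &, forall x y, x != y -> ore x y -> adj x y} ->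
  {in W &, forall x y, exists p, [/\ path adj x p, last x p = y & {subset p <= W}]} ->
  adj p1 p2.
Proof.
move=> [p1W p2W p3W] [q1W q2W q3W] [n12 n13 n23] [pq1 pq2 pq3] [nq12 nq13 nq23]
  Q1 Q2 Q3 clean conn; apply/negPn/negP => nadj.
have [p [pp lp pW]] := conn _ _ p1W p2W.
have [q [pq lq Uq qp ind]] := shortest_path_induced pp lp.
set d := size q.
pose x := nth q1 (q1 :: p1 :: rcons q q2).
have x0 : x 0 = q1 by [].
have x1 : x 1 = p1 by [].
have xq k : k <= d -> x k.+1 = nth p1 (p1 :: q) k.
  rewrite /x /= -rcons_cons nth_rcons /= => kd; rewrite ltnS kd.
  by apply: set_nth_default.
have xl : x d.+1 = p2 by rewrite xq // -lq (last_nth p1).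
have xe : x d.+2 = q2.
  by rewrite /x /= nth_rcons ltnn eqxx.
have d2 : 1 < d.
  rewrite /d; case: (q) pq lq => [|y [|z s]] //= => [_ E|/andP[+ _] E].
    by move: n12; rewrite E eqxx.
  by rewrite E (negPf nadj).
have xW k : 0 < k -> k <= d.+1 -> x k \in W.
  case: k => // k _ kd; rewrite xq //.
  have : nth p1 (p1 :: q) k \in p1 :: q by apply: mem_nth.
  by rewrite inE => /orP[/eqP->//|/qp /pW].
have xU i j : 0 < i -> i < j -> j <= d.+1 -> x i != x j.
  case: i => // i; case: j => // j _ ij jd; rewrite !xq ?nth_uniq //= -?[size q]/d; arith.
have F1 k : k <= d.+1 -> adj (x k) (x k.+1).
  case: k => [|k] kd; first by rewrite x0 x1 sedge_sym.
  move: kd; rewrite ltnS leq_eqVlt => /orP[/eqP->|kd]; first by rewrite xl xe.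
  rewrite !xq //; last by arith.
  by move/pathP: pq => /(_ p1 k kd).
have F2 i j : i.+1 < j -> j <= d.+2 -> ~~ ore (x i) (x j).
  case: i => [|i] ij.
    rewrite leq_eqVlt => /orP[/eqP->|jd]; first by rewrite x0 xe.
    by rewrite x0 Q1 ?xW //; [arith | rewrite eq_sym -x1 xU].
  rewrite leq_eqVlt => /orP[/eqP jE|jd].
    rewrite jE xe ore_adj_sym Q2 //; first by apply: xW; arith.
    by rewrite -xl xU //; arith.
  apply/negP => /(clean _ _ _ _) H.
  have {H} : adj (x i.+1) (x j) by apply: H; first [apply: xW | apply: xU]; arith.
  case: j ij jd => // j ij jd; rewrite !xq; try arith.
  move=> a1; have E : j = i.+1 by apply: ind a1; rewrite /= -?[size q]/d; arith.
  by arith.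
have xD i j : i < j -> j <= d.+2 -> x i != x j.
  move=> ij jd; apply/eqP => E.
  have [j1|] := leqP j i.+1.
    have := F1 i; rewrite (_ : i.+1 = j); last by arith.
    by rewrite E sedge_irrefl => H; have: false by apply: H; arith.
  move=> ij'; have [jE|jd'] := leqP d.+2 j.
    have := F1 i _; rewrite E => H.
    have := F2 i.+1 d.+2; rewrite (_ : j = d.+2) in H E; last by arith.
    have [?|?] := leqP d.+2 i.+2; last first.
      by move=> /(_ _ _)/negP[] //; rewrite ore_adj_sym; apply/sedge_ore/H; arith.
    by have := xW i; rewrite E xe (negPf q2W) => K; have: false by apply: K; arith.
  case: i E ij ij' => [|i] E ij ij'.
    by have := xW j; rewrite -E x0 (negPf q1W) => K; have: false by apply: K; arith.
  by have := @xU i.+1 j; rewrite E eqxx => K; have: false by apply: K; arith.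
have memX w : w \in p1 :: q -> exists2 k, 0 < k <= d.+1 & w = x k.
  move/(nthP p1) => [k /= kd <-]; exists k.+1; first exact: kd.
  by rewrite xq //; exact: kd.
have p3q : p3 \notin p1 :: q.
  apply/negP => /memX[k /andP[k0 kd] kE].
  have k1 : 1 < k.
    by case: k k0 kE {kd} => [|[|k]] // _ E; move: n13; rewrite E x1 eqxx.
  have kd' : k < d.+1.
    by rewrite ltn_neqAle kd andbT; apply: contraNneq n23 => E; rewrite kE E xl.
  have kk : k.-1.+1 = k by arith.
  have [||||||||] := claw_ore claw_heavy (x := p3) (a := x k.-1) (b := x k.+1) (c := q3).
  - by rewrite kE sedge_sym; have := F1 k.-1; rewrite kk; apply; arith.
  - by rewrite kE F1 //; arith.
  - by [].
  - by apply: xD; arith.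
  - by apply: contraNneq q3W => <-; apply: xW; arith.
  - by apply: contraNneq q3W => <-; apply: xW; arith.
  - by apply/negP/F2; arith.
  - apply/negP; rewrite ore_adj_sym; apply: Q3; first by apply: xW; arith.
    by rewrite kE; apply: xD; arith.
  - apply/negP; rewrite ore_adj_sym; apply: Q3; first by apply: xW; arith.
    by rewrite kE eq_sym; apply: xD; arith.
pose nb := [pred y | has (adj y) (p1 :: q)].
have nbx k : 0 < k <= d.+1 -> nb (x k).
  move=> /andP[k0 kd]; apply/hasP.
  have xm j : 0 < j <= d.+1 -> x j \in p1 :: q.
    by case: j => // j jd; rewrite xq ?mem_nth //=; arith.
  have [k1|k1] := ltnP k d.+1; first by exists (x k.+1); [apply: xm | apply: F1]; arith.
  exists (x k.-1); first by apply: xm; arith.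
  by rewrite sedge_sym; have := F1 k.-1; rewrite (_ : k.-1.+1 = k); [apply|]; arith.
have [s [ps ls sW]] := conn _ _ p3W p1W.
have nq3 : ~~ nb q3.
  apply/hasPn => w wq; apply: contraNN p3q => q3w.
  have [->//|wp3] := eqVneq p3 w.
  have wW : w \in W by move: wq => /memX[k /andP[? ?] ->]; apply: xW.
  by exfalso; apply: (negP (Q3 w wW _)); [rewrite eq_sym | apply: sedge_ore].
have [||a [y [aP yP ay na ny]]] := path_first (r := adj) (x := q3) (p := p3 :: s) _ nq3.
- by rewrite /= sedge_sym pq3.
- by rewrite /= ls -x1; apply: nbx.
have yW : y \in W by move: yP; rewrite inE => /orP[/eqP->//|/sW].
have ax k : 0 < k <= d.+1 -> a != x k.
  by move=> /nbx; apply: contraTneq => <-.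
have yx k : 0 < k <= d.+1 -> y != x k.
  move=> kd; apply: contraNneq na => E; apply/hasP; exists y => //.
  by case: k E kd => // k -> kd; rewrite xq ?mem_nth //=; arith.
have nadjE w k : ~~ nb w -> 0 < k <= d.+1 -> ~~ adj w (x k).
  move=> /hasPn nw; case: k => // k kd; apply: nw.
  by rewrite xq ?mem_nth //=; arith.
have aW : a = q3 \/ a \in W.
  move: aP; rewrite !inE => /or3P[/eqP->|/eqP->|/sW]; by [left | right].
have kcases k : k <= d.+2 -> [\/ k = 0, k = d.+2 | 0 < k <= d.+1].
  have [->|k0] := posnP k; first by constructor 1.
  by rewrite leq_eqVlt => /orP[/eqP->|kd]; [constructor 2|constructor 3; apply/andP].
have yX k : k <= d.+2 -> y != x k.
  case/kcases => [->|->|/yx//]; rewrite ?x0 ?xe.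
    by apply: contraNneq q1W => <-.
  by apply: contraNneq q2W => <-.
have G1 k : k <= d.+2 -> ~~ ore a (x k).
  case/kcases => [->|->|kd].
  - rewrite x0 ore_adj_sym; case: aW => [->//|aW]; apply: Q1 => //.
    by rewrite -x1 ax.
  - rewrite xe ore_adj_sym; case: aW => [->//|aW]; apply: Q2 => //.
    by rewrite -xl ax //; arith.
  - case: aW => [->|aW].
      apply: Q3; first by case/andP: kd; apply: xW.
      apply: contraNneq p3q => <-.
      by case: k kd => // k kd; rewrite xq ?mem_nth //=; arith.
    apply/negP => /clean H; case/negP: (nadjE _ _ na kd); apply: H => //.
      by case/andP: kd; apply: xW.
    exact: ax.
have Y k : k <= d.+2 -> ore y (x k) -> 0 < k <= d.+1 /\ adj y (x k).
  case/kcases => [->|->|kd] oy.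
  - by exfalso; apply: (negP (Q1 y yW _)); [rewrite -x1 yx | rewrite ore_adj_sym].
  - by exfalso; apply: (negP (Q2 y yW _)); [rewrite -xl yx //; arith | rewrite ore_adj_sym -xe].
  - split=> //; apply: clean => //; last exact: yx.
    by case/andP: kd; apply: xW.
have exi : exists i, (0 < i <= d.+1) && adj y (x i).
  by case/hasP: ny => w /memX[k kd ->] yk; exists k; rewrite kd.
case: (ex_minnP exi) => i /andP[id yi] imin.
have id1 : i.-1.+1 = i by arith.
have low k : k < i -> ~~ ore y (x k).
  move=> ki; apply/negP => /Y[|kd yk]; first by arith.
  by have := imin k; rewrite kd yk => /(_ isT); arith.
have yi1 : ore y (x i.+1).
  have [||||||||] := claw_ore claw_heavy (x := x i) (a := x i.-1) (b := x i.+1) (c := y).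
  - by rewrite sedge_sym; have := F1 i.-1; rewrite id1; apply; arith.
  - by apply: F1; arith.
  - by rewrite sedge_sym.
  - by apply: xD; arith.
  - by rewrite eq_sym yX //; arith.
  - by rewrite eq_sym yX //; arith.
  - by move=> H; exfalso; apply: (negP (F2 i.-1 i.+1 _ _)) H; arith.
  - by rewrite ore_adj_sym => H; exfalso; apply: (negP (low i.-1 _)) H; arith.
  - by rewrite ore_adj_sym.
have [id' yi1'] := Y i.+1 ltac:(arith) yi1.
have high k : i.+1 < k -> k <= d.+2 -> ~~ ore y (x k).
  move=> ki kd; apply/negP => /Y[//|kd' yk].
  have [||||||||] := claw_ore claw_heavy (x := y) (a := x i) (b := x k) (c := a) => //.
  - by rewrite sedge_sym.
  - by apply: xD; arith.
  - by rewrite eq_sym ax.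
  - by rewrite eq_sym ax.
  - by apply/negP/F2.
  - by apply/negP; rewrite ore_adj_sym; apply: G1; arith.
  - by apply/negP; rewrite ore_adj_sym; apply: G1; arith.
have F2' j k : k.+1 < j -> j <= d.+2 -> ~~ ore (x j) (x k).
  by move=> *; rewrite ore_adj_sym; apply: F2.
have ya : adj y a by rewrite sedge_sym.
have G1' k : k <= d.+2 -> ~~ ore (x k) a by move=> *; rewrite ore_adj_sym; apply: G1.
have low' k : k < i -> ~~ ore (x k) y by move=> *; rewrite ore_adj_sym; apply: low.
have F1' k : k <= d.+1 -> adj (x k.+1) (x k) by move=> *; rewrite sedge_sym; apply: F1.
have [i2|i2] := ltnP 1 i.
  have [j jE] : exists j, i = j.+2 by exists i.-2; arith.
  subst i; apply: (@N112_ore G N112_heavy y (x j.+3) (x j.+2) a (x j.+4) (x j.+1) (x j)).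
  1: by split=> //; apply: F1'; arith.
  1: by split=> //; [apply: F1|apply: F1'|apply: F1']; arith.
  1-3: by split; first [by apply: F2; arith | by apply: F2'; arith | by apply: G1; arith
    | by apply: G1'; arith | by apply: low; arith | by apply: high; arith].
have E1 : i = 1 by arith.
rewrite E1 in id yi id' yi1' high.
apply: (@N112_ore G N112_heavy y (x 1) (x 2) a (x 0) (x 3) (x 4)).
1: by split=> //; apply: F1; arith.
1: by split; first [done | by apply: F1; arith | by apply: F1'; arith].
1-3: by split; first [by apply: F2; arith | by apply: F2'; arith | by apply: G1; arith
  | by apply: G1'; arith | by apply: low; arith | by apply: high; arith].
Qed.

End Ports.

Section CleanBlob.
Variable G : sgraph.
Local Notation adj := (@sedge G).
Local Notation ore := (@ore_adj G).
Hypothesis claw_heavy : graph_heavy claw G.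
Hypothesis N112_heavy : graph_heavy N112 G.
Hypothesis deer_heavy : graph_heavy deer G.

(* By the first three clauses no constructor of [blob] extends the interval u f b
   by its outer neighbours x1 and x2. *)
Record maximal_blob (u : G) f b x1 x2 : Prop := MaximalBlob {
  mb_x1 : {in u :: behead f ++ b, forall s, ~~ ore x1 s};
  mb_x2 : {in u :: f ++ behead b, forall s, ~~ ore x2 s};
  mb_x12 : ~~ ore x1 x2;
  mb_f : path adj u (rev f) /\ adj (head u f) x1;
  mb_b : path adj u (rev b) /\ adj (head u b) x2 }.

Lemma arm_connected (u : G) f b : path adj u (rev f) -> path adj u (rev b) ->
  {in u :: f ++ b &, forall x y,
    exists p, [/\ path adj x p, last x p = y & {subset p <= u :: f ++ b}]}.
Proof.
move=> pf pb.
have from_u w : w \in u :: f ++ b ->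
    exists2 p, walk adj u w p & {subset p <= u :: f ++ b}.
  have arm s : path adj u s -> {subset s <= f ++ b} -> w \in u :: s ->
      exists2 p, walk adj u w p & {subset p <= u :: f ++ b}.
    move=> ps sub ws; case/splitPl: ws ps sub => p1 p2 lp; rewrite cat_path => /andP[pp _] sub.
    exists (u :: p1); first by rewrite -lp; apply: walk_path.
    move=> t; rewrite !inE => /orP[->//|tp].
    by rewrite sub ?orbT // mem_cat tp.
  rewrite inE mem_cat orbA => /orP[wf|wb].
    apply: (arm (rev f)) => //; last by rewrite inE mem_rev.
    by move=> t; rewrite mem_rev mem_cat => ->.
  apply: (arm (rev b)) => //; last by rewrite inE mem_rev wb orbT.
  by move=> t; rewrite mem_rev mem_cat => ->; rewrite orbT.
move=> x y /from_u[p wp sp] /from_u[q wq sq].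
have adj_sym := @sedge_sym G.
have [p' pE] : exists p', rev p = x :: p'.
  by exists (behead (rev p)); rewrite -(walk_head (walk_rev adj_sym wp)).
have wp' := walk_rev adj_sym wp; rewrite pE in wp'.
have [q' qE] : exists q', q = u :: q' by exists (behead q); rewrite -(walk_head wq).
rewrite qE in wq sq; move: wp' wq => /and3P[_ pp /eqP lp] /and3P[_ pq /eqP lq].
exists (p' ++ q'); split.
- by rewrite cat_path pp lp.
- by rewrite last_cat lp.
- move=> t; rewrite mem_cat => /orP[tp|tq]; last by rewrite sq // inE tq orbT.
  by rewrite sp // -mem_rev pE inE tp orbT.
Qed.

Section Contradiction.
Variables (u v x1 y1 x2 y2 z : G) (f b g h S1 S2 : seq G).
Hypothesis cf : conf ore u f b v g h x1 y1 S1 x2 y2 S2 z z [:: z].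
Hypothesis Ublobs : uniq ((u :: f ++ b) ++ (v :: g ++ h)).
Hypothesis outside : [/\ x1 \notin u :: f ++ b, x2 \notin u :: f ++ b & z \notin u :: f ++ b].
Hypothesis mu : maximal_blob u f b x1 x2.
Hypothesis uz : adj u z.
Hypothesis clean : {in u :: f ++ b &, forall x y, x != y -> ore x y -> adj x y}.
Let K := head u b.
Let L := head u f.

Let ore_sym := @ore_adj_sym G.

Lemma heads_mem : L \in f /\ K \in b.
Proof.
by have [Ef Eb] := blob_arms (cf_u cf); rewrite /L /K Ef Eb !mem_head.
Qed.

Lemma heads_neq : [/\ L != K, L != u & K != u].
Proof.
have [Lf Kb] := heads_mem.
move: Ublobs; rewrite cat_uniq => /andP[]; rewrite cons_uniq mem_cat negb_or => /andP[].
move=> /andP[uf ub]; rewrite cat_uniq => /and3P[_ /hasPn fb _] _.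
split; last by apply: contraNneq ub => <-.
  by apply: contraTneq (fb _ Kb) => <-; rewrite negbK.
by apply: contraNneq uf => <-.
Qed.

Lemma z_off s : s \in f ++ b -> ~~ ore z s.
Proof.
rewrite mem_cat => /orP[sf|sb]; apply/negP.
  exact: (off_cycle_left ore_sym cf).
exact: (off_cycle_left ore_sym (conf_mirror ore_sym cf)).
Qed.

Lemma z_x12 : ~~ ore z x1 /\ ~~ ore z x2.
Proof.
split; apply/negP; first exact: (off_cycle_x1 ore_sym cf).
exact: (off_cycle_x1 ore_sym (conf_mirror ore_sym cf)).
Qed.

Lemma x1_off s : s \in u :: f ++ b -> s != L -> ~~ ore x1 s.
Proof.
have [Ef Eb] := blob_arms (cf_u cf).
rewrite Ef -/L => sI sL; apply: (mb_x1 mu).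
by move: sI; rewrite !(inE, mem_cat) (negPf sL).
Qed.

Lemma x2_off s : s \in u :: f ++ b -> s != K -> ~~ ore x2 s.
Proof.
have [Ef Eb] := blob_arms (cf_u cf).
rewrite Eb -/K => sI sK; apply: (mb_x2 mu).
by move: sI; rewrite !(inE, mem_cat) (negPf sK).
Qed.

Lemma blob_triangle : [/\ adj L K, adj u L & adj u K].
Proof.
have [Lf Kb] := heads_mem; have [nLK nLu nKu] := heads_neq.
have [x1o x2o zo] := outside; have [zx1 zx2] := z_x12.
have [pf Lx1] := mb_f mu; have [pb Kx2] := mb_b mu.
have Li : L \in u :: f ++ b by rewrite !(inE, mem_cat) Lf orbT.
have Ki : K \in u :: f ++ b by rewrite !(inE, mem_cat) Kb !orbT.
have ui : u \in u :: f ++ b by rewrite mem_head.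
have zE s : s \in u :: f ++ b -> s != u -> ~~ ore z s.
  by rewrite inE => /orP[->//|si] _; apply: z_off.
have conn := arm_connected pf pb.
have nx12 := mb_x12 mu.
have [nuL nuK] : u != L /\ u != K by rewrite ![u == _]eq_sym.
have nx1z : ~~ ore x1 z by rewrite ore_sym.
have nx2z : ~~ ore x2 z by rewrite ore_sym.
have [nKL nx21] : K != L /\ ~~ ore x2 x1 by rewrite eq_sym ore_sym.
have pa := ports_adj claw_heavy N112_heavy.
split.
- by apply: (pa _ L K u x1 x2 z) clean conn => // *;
  first [exact: x1_off | exact: x2_off | exact: zE].
- by rewrite sedge_sym; apply: (pa _ L u K x1 z x2) clean conn => // *;
  first [exact: x1_off | exact: x2_off | exact: zE].
- by rewrite sedge_sym; apply: (pa _ K u L x2 z x1) clean conn => // *;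
  first [exact: x1_off | exact: x2_off | exact: zE].
Qed.

Lemma no_long_leg w : adj z w -> ~~ ore u w ->
  (forall s, s \in f ++ b -> ~~ ore w s) -> ~~ ore w x1 -> ~~ ore w x2 -> False.
Proof.
move=> zw uw wI wx1 wx2.
have [Lf Kb] := heads_mem; have [nLK nLu nKu] := heads_neq.
have [LK uL uK] := blob_triangle; have [zx1 zx2] := z_x12.
have [pf Lx1] := mb_f mu; have [pb Kx2] := mb_b mu.
have Lf' : L \in f ++ b by rewrite mem_cat Lf.
have Kf' : K \in f ++ b by rewrite mem_cat Kb orbT.
have Li : L \in u :: f ++ b by rewrite inE Lf' orbT.
have Ki : K \in u :: f ++ b by rewrite inE Kf' orbT.
have ui : u \in u :: f ++ b by rewrite mem_head.
have x2L := x2_off Li nLK; have x1u : ~~ ore x1 u by apply: x1_off; rewrite 1?eq_sym.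
have x1K : ~~ ore x1 K by apply: x1_off; rewrite 1?eq_sym.
have x2u : ~~ ore x2 u by apply: x2_off; rewrite 1?eq_sym.
have nx12 := mb_x12 mu.
have [zL zK wL wK] := And4 (z_off Lf') (z_off Kf') (wI _ Lf') (wI _ Kf').
apply: (N112_ore N112_heavy (a := L) (b := K) (c := u) (a1 := x1) (b1 := x2) (c1 := z) (c2 := w));
  by split=> //; first [rewrite sedge_sym | rewrite ore_sym].
Qed.

Hypothesis zv : adj z v.
Hypothesis uv : adj u v.
Hypothesis mv : maximal_blob v g h y1 y2.

Lemma no_triangle_through_z : False.
Proof.
have [Lf Kb] := heads_mem; have [nLK nLu nKu] := heads_neq.
have [LK uL uK] := blob_triangle; have [zx1 zx2] := z_x12.
have [pf Lx1] := mb_f mu; have [pb Kx2] := mb_b mu.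
have [pg gy1] := mb_f mv; have [ph hy2] := mb_b mv.
have Lf' : L \in f ++ b by rewrite mem_cat Lf.
have Kf' : K \in f ++ b by rewrite mem_cat Kb orbT.
have Li : L \in u :: f ++ b by rewrite inE Lf' orbT.
have Ki : K \in u :: f ++ b by rewrite inE Kf' orbT.
have ui : u \in u :: f ++ b by rewrite mem_head.
have zv' := sedge_ore zv; have zu' : ore z u by rewrite ore_sym sedge_ore.
have cfm := conf_mirror ore_sym cf.
have cfs := conf_swap ore_sym zv' cf.
have cfms := conf_swap ore_sym zv' cfm.
have [Eg Eh] := blob_arms (cf_v cf).
have x1u : ~~ ore x1 u by apply: x1_off; rewrite 1?eq_sym.
have x2u : ~~ ore x2 u by apply: x2_off; rewrite 1?eq_sym.
have vL : ~~ ore v L by apply/negP/(v_left ore_sym cf zv').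
have vK : ~~ ore v K by apply/negP/(v_left ore_sym cfm zv').
have vx1 : ~~ ore v x1 by apply/negP/(v_x1 ore_sym cf zv').
have vx2 : ~~ ore v x2 by apply/negP/(v_x1 ore_sym cfm zv').
have [Uu Uv] : uniq (u :: f ++ b) /\ uniq (v :: g ++ h).
  by move: Ublobs; rewrite cat_uniq => /and3P[].
move: Uv; rewrite cons_uniq mem_cat negb_or cat_uniq => /andP[/andP[vg vh]].
move=> /and3P[Ug /hasPn ngh Uh].
have ht t : t \in h -> t != head v g.
  by move=> th; apply: contraNneq (ngh _ th) => ->; rewrite Eg mem_head.
have Lt t : t \in h -> ~~ ore L t.
  move=> th; apply/negP => Lt.
  have tJ : t \in v :: g ++ h by rewrite inE mem_cat th !orbT.
  case: (cross ore_sym cf zv' Li tJ Lt) => -[].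
  - by move=> E; rewrite E eqxx in nLu.
  - by move=> _ /eqP; rewrite (negPf (ht _ th)).
  - by move=> /eqP; rewrite (negPf nLK).
have ut t : t \in h -> ~~ ore u t by move=> th; apply/negP/(v_left ore_sym cfms zu').
have x1t t : t \in h -> ~~ ore x1 t.
  move=> th; apply/negP/(x1_blob ore_sym cf zv').
  by rewrite inE mem_cat th !orbT.
have [hh|hh] := leqP (size h) 1.
  have hE : h = [:: head v h].
    by case: (h) hh Eh => [|c []].
  have hm : head v h \in h by rewrite Eh mem_head.
  have vh1 : adj v (head v h).
    by move: ph; rewrite {1}hE /= => /andP[].
  have zt : ~~ ore z (head v h) by apply/negP/(off_cycle_left ore_sym cfms).
  have zy2 : ~~ ore z y2 by apply/negP/(off_cycle_x1 ore_sym cfms).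
  have uy2 : ~~ ore u y2 by apply/negP/(v_x1 ore_sym cfms zu').
  have x1y2 : ~~ ore x1 y2 by apply/negP/(x1_y2 ore_sym cf zv').
  have y2v : ~~ ore y2 v.
    apply: (mb_x2 mv); exact: mem_head.
  have y2L : ~~ ore y2 L.
    by apply/negP/(x1_blob ore_sym cfms zu'); rewrite inE mem_cat Lf !orbT.
  have [Lh uh x1h] := And3 (Lt _ hm) (ut _ hm) (x1t _ hm).
  have zL := z_off Lf'.
  apply: (deer_ore deer_heavy (a := u) (b := v) (c := z) (a1 := L) (a2 := x1)
    (b1 := head v h) (b2 := y2)); split=> //; by first [rewrite sedge_sym | rewrite ore_sym].
set t := last v h.
have th : t \in behead h.
  by rewrite /t; case: (h) hh => [|? [|? ?]] //= _; apply: mem_last.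
have thh : t \in h by rewrite Eh inE th orbT.
have vt : adj v t.
  have : h = rcons (belast (head v h) (behead h)) t.
    by rewrite /t; case: (h) Eh => [|? ?] //= _; rewrite -lastI.
  by move=> hE; move: ph; rewrite hE rev_rcons /= => /andP[].
have tn : t != head v h.
  by apply: contraTneq Uh => E; rewrite Eh cons_uniq -{1}E th.
have Kt : ~~ ore K t.
  apply/negP => Kt.
  have tJ : t \in v :: g ++ h by rewrite inE mem_cat thh !orbT.
  case: (cross ore_sym cf zv' Ki tJ Kt) => -[].
  - by move=> E; rewrite E eqxx in nKu.
  - by move=> /esym /eqP; rewrite (negPf nLK).
  - by move=> _ /eqP; rewrite (negPf tn).
have x2t : ~~ ore x2 t.
  by apply/negP/(x1_blob ore_sym cfm zv'); rewrite inE mem_cat th !orbT.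
have x2L := x2_off Li nLK.
have x1K : ~~ ore x1 K by apply: x1_off; rewrite 1?eq_sym.
have [Lt' ut' x1t'] := And3 (Lt _ thh) (ut _ thh) (x1t _ thh).
have nx12 := mb_x12 mu.
apply: (N112_ore N112_heavy (a := L) (b := K) (c := u) (a1 := x1) (b1 := x2) (c1 := v) (c2 := t));
  by split=> //; first [rewrite sedge_sym | rewrite ore_sym].
Qed.

End Contradiction.
End CleanBlob.

Section NextPrev.
Variable T : eqType.
Implicit Types (s : seq T) (x y : T).

Lemma next_mid s1 s2 x y : uniq (s1 ++ [:: x, y & s2]) -> next (s1 ++ [:: x, y & s2]) x = y.
Proof.
move=> U; rewrite -(next_rot (size s1) U) rot_size_cat.
by rewrite /= eqxx.
Qed.

Lemma prev_mid s1 s2 x y : uniq (s1 ++ [:: x, y & s2]) -> prev (s1 ++ [:: x, y & s2]) y = x.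
Proof. by move=> U; rewrite -{2}(next_mid U) prev_next. Qed.

Lemma path_skip (r : rel T) (R : pred T) a s :
  path r a s -> ~~ R a -> ~~ R (last a s) ->
  (forall s1 x y x' s2, a :: s = s1 ++ [:: x, y, x' & s2] -> R y ->
     [/\ r x x', ~~ R x & ~~ R x']) ->
  path r a [seq x <- s | ~~ R x] /\ last a [seq x <- s | ~~ R x] = last a s.
Proof.
have [n] := ubnP (size s); elim: n a s => // n IH a [|b s] //= sn /andP[ab bs] Ra Rl H.
case: (boolP (R b)) => Rb /=; last first.
  have [||p1 p2] := IH b s _ bs Rb Rl; first by move: sn; arith.
    by move=> s1 x y x' s2 E; apply: (H (a :: s1) x y x' s2); rewrite E.
  by rewrite ab.
case: s sn bs Rl H => [|x' s] /= sn; first by rewrite Rb.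
move=> /andP[bx xs] Rl H.
have [ax _ Rx] := H [::] a b x' s erefl Rb.
rewrite Rx /= ax.
apply: (IH x' s) => //; first by move: sn; arith.
by move=> s1 x y y' s2 E; apply: (H [:: a, b & s1] x y y' s2); rewrite E.
Qed.

End NextPrev.

Section Insertion.
Variable G : sgraph.
Local Notation adj := (@sedge G).
Local Notation ore := (@ore_adj G).
Variable c : seq G.
Hypothesis cyc : ucycle adj c.
Hypothesis longest : forall s, ucycle ore s -> size s <= size c.

(* The vertices in R are bypassed and the vertices in I are inserted between
   a and its successor. *)
Lemma no_insertion a w1 w2 (R I : seq G) :
  a \in c -> a \notin R -> next c a \notin R ->
  {in R, forall y, [/\ y \in c, ore (prev c y) (next c y), prev c y \notin R
     & next c y \notin R]} ->
  walk ore w1 w2 I -> uniq I -> ore a w1 -> ore w2 (next c a) ->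
  {in I, forall x, x \in c -> x \in R} -> size R < size I -> False.
Proof.
move=> ac aR bR HR wI UI aw wb sub sz.
move: cyc => /andP[cc Uc].
set b := next c a in bR wb.
have bc : b \in c by rewrite mem_next.
have [i s rE] := rot_to bc.
have rU : uniq (b :: s) by rewrite -rE rot_uniq.
have nE x : next (b :: s) x = next c x by rewrite -rE next_rot.
have pE x : prev (b :: s) x = prev c x by rewrite -rE prev_rot.
have la : last b s = a.
  have : next (b :: s) (last b s) = b.
    rewrite -(next_rot (size s) rU) lastI -[in rot _ _](size_belast b s) -cats1 rot_size_cat.
    by case: (s) => [|x t] /=; rewrite eqxx.
  by rewrite nE => E; apply: (can_inj (prev_next Uc)).
have : cycle adj (b :: s) by rewrite -rE rot_cycle.
rewrite /= rcons_path => /andP[bs _].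
have bs' : path ore b s by apply: sub_path bs => x y; apply: sedge_ore.
have [|||p1 p2] := @path_skip _ ore (mem R) b s bs'.
- by [].
- by rewrite la.
- move=> s1 x y x' s2 E yR.
  have [_ o1 o2 o3] := HR _ yR.
  have px : prev c y = x by rewrite -pE E prev_mid // -E.
  have nx : next c y = x'.
    by rewrite -nE E -cat_rcons next_mid // cat_rcons -E.
  by rewrite -px -nx.
set s' := filter _ s in p1 p2.
have w0 : walk ore b a (b :: s') by rewrite -la -p2; apply: walk_path.
have w3 := walk_cat w0 aw wI.
have cy := walk_cycle w3 wb.
have := longest (s := (b :: s') ++ I); rewrite /ucycle cy cat_uniq UI andbT.
have sub' x : x \in b :: s' -> x \in c /\ x \notin R.
  rewrite inE => /orP[/eqP->//|]; rewrite mem_filter => /andP[xR xs]; split=> //.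
  by rewrite -(mem_rot i) rE inE xs orbT.
have -> : uniq (b :: s').
  by move: rU; rewrite /= mem_filter => /andP[bs1 Us]; rewrite filter_uniq // negb_and bs1 orbT.
have -> : ~~ has [in b :: s'] I.
  apply/hasPn => x xI; apply/negP => /sub'[xc /negP]; apply; exact: sub.
move=> /(_ isT); rewrite size_cat /= -(size_rot i c) rE /= size_filter.
have := count_predC (mem R) s.
have cR : count (mem R) s <= size R.
  rewrite -size_filter; apply: uniq_leq_size.
    by apply: filter_uniq; case/andP: rU.
  by move=> x; rewrite mem_filter => /andP[].
have -> : count (predC (mem R)) s = count (fun x => ~~ mem R x) s by [].
by move=> e1 e2; arith.
Qed.

End Insertion.

Section Attachments.
Variable G : sgraph.
Local Notation adj := (@sedge G).
Local Notation ore := (@ore_adj G).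
Hypothesis claw_heavy : graph_heavy claw G.
Variable c : seq G.
Hypothesis cyc : ucycle adj c.
Hypothesis c3 : 2 < size c.
Hypothesis longest : forall s, ucycle ore s -> size s <= size c.

Let ore_sym := @ore_adj_sym G.
Let adj_sym := @sedge_sym G.
Let Uc : uniq c. Proof. by case/andP: cyc. Qed.

Lemma sedge_neq (x y : G) : adj x y -> x != y.
Proof. by apply: contraTneq => ->; rewrite sedge_irrefl. Qed.

Lemma next_adj x : x \in c -> adj x (next c x).
Proof. by apply: next_cycle; case/andP: cyc. Qed.

Lemma prev_adj x : x \in c -> adj (prev c x) x.
Proof. by apply: prev_cycle; case/andP: cyc. Qed.

Lemma prev_neq_next x : x \in c -> prev c x != next c x.
Proof.
move=> xc; have [i s E] := rot_to xc.
have U : uniq (x :: s) by rewrite -E rot_uniq.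
rewrite -(next_rot i Uc) -(prev_rot i Uc) E.
have sz : 1 < size s by rewrite -ltnS -[(size s).+1]/(size (x :: s)) -E size_rot.
case: s sz U {E} => [|y [|y' s]] // _ U.
have nx : next [:: x, y, y' & s] x = y by rewrite /= eqxx.
have [xy xy'] : x != y /\ x != y'.
  by have /= := U; rewrite !inE !negb_or => /and3P[/and3P[]].
have ny : next [:: x, y, y' & s] y = y' by rewrite /= eq_sym (negPf xy) eqxx.
rewrite nx; apply/eqP => E; have := next_prev U x; rewrite E ny => H.
by rewrite H eqxx in xy'.
Qed.

Lemma attach_next z x : z \notin c -> x \in c -> ore z x -> ~~ ore z (next c x).
Proof.
move=> zc xc zx; apply/negP => zn.
apply: (no_insertion cyc longest (a := x) (w1 := z) (w2 := z) (R := [::]) (I := [:: z])) => //.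
- exact: walk1.
- by rewrite ore_sym.
- by move=> y; rewrite inE => /eqP->; rewrite (negPf zc).
Qed.

Lemma attach_prev z x : z \notin c -> x \in c -> ore z x -> ~~ ore z (prev c x).
Proof.
move=> zc xc zx; apply/negP => zn.
have := attach_next zc _ zn; rewrite mem_prev xc next_prev // zx.
by move/(_ isT).
Qed.

Lemma bypass z x : z \notin c -> x \in c -> adj z x -> ore (prev c x) (next c x).
Proof.
move=> zc xc zx.
have [||||||//|H|H] := claw_ore claw_heavy (x := x) (a := prev c x) (b := next c x) (c := z).
- by rewrite adj_sym prev_adj.
- exact: next_adj.
- by rewrite adj_sym.
- exact: prev_neq_next.
- by apply: contraNneq zc => <-; rewrite mem_prev.
- by apply: contraNneq zc => <-; rewrite mem_next.
- by case/negP: (attach_prev zc xc (sedge_ore zx)); rewrite ore_sym.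
- by case/negP: (attach_next zc xc (sedge_ore zx)); rewrite ore_sym.
Qed.

Section Common.
Variables (z : G).
Hypothesis zc : z \notin c.

Lemma attached_apart u v : u \in c -> v \in c -> adj z u -> adj z v ->
  [/\ next c u != v, prev c u != v, next c u != u & prev c u != u].
Proof.
move=> uc vc zu zv; split.
- apply: contraTneq (attach_next zc uc (sedge_ore zu)) => ->.
  by rewrite negbK sedge_ore.
- apply: contraTneq (attach_prev zc uc (sedge_ore zu)) => ->.
  by rewrite negbK sedge_ore.
- by rewrite eq_sym sedge_neq // next_adj.
- by rewrite sedge_neq // prev_adj.
Qed.

Lemma no_crossing u v x : u \in c -> v \in c -> adj z u -> adj z v -> u != v ->
  x \in c -> x \notin [:: u; v] -> next c x \notin [:: u; v] ->
  ore v x -> ore u (next c x) -> False.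
Proof.
move=> uc vc zu zv uv xc xR nR vx ux.
have [a1 a2 a3 a4] := attached_apart uc vc zu zv.
have [b1 b2 b3 b4] := attached_apart vc uc zv zu.
apply: (no_insertion cyc longest (a := x) (w1 := v) (w2 := u) (R := [:: u; v]) (I := [:: v; z; u])) => //.
- by move=> y; rewrite !inE => /orP[] /eqP->; split; rewrite // ?inE ?negb_or;
   try apply/andP; try split; rewrite ?(bypass zc).
- by rewrite /walk /= !eqxx ore_sym !sedge_ore.
- have vz : v != z by apply: contraNneq zc => <-.
  have zu' : z != u by apply: contraNneq zc => ->.
  by rewrite /= !inE !negb_or vz zu' (eq_sym v) uv.
- by rewrite ore_sym.
- move=> y; rewrite !inE => /or3P[]/eqP->; rewrite ?eqxx ?orbT //.
  by rewrite (negPf zc).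
Qed.

Lemma no_shortcut u v : u \in c -> v \in c -> adj z u -> adj z v -> u != v ->
  ~~ ore v (next c u) /\ ~~ ore v (prev c u).
Proof.
move=> uc vc zu zv uv.
have [a1 a2 a3 a4] := attached_apart uc vc zu zv.
have [b1 b2 b3 b4] := attached_apart vc uc zv zu.
have zv' : z != v by apply: contraNneq zc => ->.
have byp : {in [:: v], forall y, [/\ y \in c, ore (prev c y) (next c y),
    prev c y \notin [:: v] & next c y \notin [:: v]]}.
  by move=> y; rewrite inE => /eqP->; rewrite !inE; split; rewrite // (bypass zc).
split; apply/negP => vn.
  apply: (no_insertion cyc longest (a := u) (w1 := z) (w2 := v) (R := [:: v]) (I := [:: z; v])) => //.
  - by rewrite inE.
  - by rewrite inE.
  - by rewrite /walk /= !eqxx sedge_ore.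
  - by rewrite /= inE zv'.
  - by rewrite ore_sym sedge_ore.
  - move=> y; rewrite !inE => /orP[]/eqP->; rewrite ?eqxx //.
    by rewrite (negPf zc).
apply: (no_insertion cyc longest (a := prev c u) (w1 := v) (w2 := z) (R := [:: v]) (I := [:: v; z])) => //.
- by rewrite mem_prev.
- by rewrite inE.
- by rewrite next_prev // inE.
- by rewrite /walk /= !eqxx ore_sym sedge_ore.
- by rewrite /= inE eq_sym zv'.
- by rewrite ore_sym.
- by rewrite next_prev // sedge_ore.
- move=> y; rewrite !inE => /orP[]/eqP->; rewrite ?eqxx //.
  by rewrite (negPf zc).
Qed.

Lemma common_neighbour u v x : u \in c -> v \in c -> adj z u -> adj z v -> u != v ->
  x \in c -> adj u x -> adj v x ->
  [/\ ore z x, ~~ adj u (next c x), ~~ adj v (next c x) & next c x \notin [:: u; v]].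
Proof.
move=> uc vc zu zv uv xc ux vx.
have [a1 a2 a3 a4] := attached_apart uc vc zu zv.
have [b1 b2 b3 b4] := attached_apart vc uc zv zu.
have vu : v != u by rewrite eq_sym.
have [s1 s2] := no_shortcut uc vc zu zv uv.
have [t1 t2] := no_shortcut vc uc zv zu vu.
have xR : x \notin [:: u; v] by rewrite !inE negb_or ![x == _]eq_sym !sedge_neq.
have xnu : x != next c u by apply: contraNneq s1 => <-; rewrite sedge_ore.
have xpu : x != prev c u by apply: contraNneq s2 => <-; rewrite sedge_ore.
have xnv : x != next c v by apply: contraNneq t1 => <-; rewrite sedge_ore.
have xpv : x != prev c v by apply: contraNneq t2 => <-; rewrite sedge_ore.
have nR : next c x \notin [:: u; v].
  rewrite !inE negb_or; apply/andP; split.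
    by apply: contraNneq xpu => <-; rewrite prev_next.
  by apply: contraNneq xpv => <-; rewrite prev_next.
have pR : prev c x \notin [:: u; v].
  rewrite !inE negb_or; apply/andP; split.
    by apply: contraNneq xnu => <-; rewrite next_prev.
  by apply: contraNneq xnv => <-; rewrite next_prev.
have sw y : y \notin [:: u; v] -> y \notin [:: v; u] by rewrite !inE orbC.
have pc : prev c x \in c by rewrite mem_prev.
have un : ~~ ore u (next c x).
  by apply/negP; apply: (no_crossing uc vc zu zv) => //; exact: sedge_ore.
have vn : ~~ ore v (next c x).
  by apply/negP; apply: (no_crossing vc uc zv zu) => //; rewrite ?sw // sedge_ore.
have up : ~~ ore u (prev c x).
  apply/negP => H; apply: (no_crossing vc uc zv zu vu pc _ _ H); rewrite ?sw //.
    by rewrite next_prev // sw.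
  by rewrite next_prev // sedge_ore.
have nadj y w : ~~ ore y w -> ~~ adj y w by apply: contraNN; apply: sedge_ore.
split; rewrite ?nadj //.
apply/negPn/negP => zx.
have byx : ore (prev c x) (next c x).
  have [||||||//|H|H] := claw_ore claw_heavy (x := x) (a := prev c x) (b := next c x) (c := u).
  - by rewrite adj_sym prev_adj.
  - exact: next_adj.
  - by rewrite adj_sym.
  - exact: prev_neq_next.
  - by move: pR; rewrite !inE negb_or => /andP[].
  - by move: nR; rewrite !inE negb_or => /andP[].
  - by case/negP: up; rewrite ore_sym.
  - by case/negP: un; rewrite ore_sym.
have zx' : z != x by apply: contraNneq zc => ->.
have zv' : z != v by apply: contraNneq zc => ->.
have xv : x != v by move: xR; rewrite !inE negb_or => /andP[].
have xn : ore x (next c u).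
  have [||||||H|H|//] := claw_ore claw_heavy (x := u) (a := z) (b := x) (c := next c u) => //.
  - by rewrite adj_sym.
  - exact: next_adj.
  - by apply: contraNneq zc => ->; rewrite mem_next.
  - by rewrite H in zx.
  - by case/negP: (attach_next zc uc (sedge_ore zu)).
apply: (no_insertion cyc longest (a := u) (w1 := z) (w2 := x) (R := [:: x; v]) (I := [:: z; v; x])) => //.
- by move: xR; rewrite !inE !negb_or eq_sym uv andbT => /andP[].
- by rewrite !inE negb_or eq_sym xnu.
- move=> y; rewrite !inE => /orP[]/eqP->; rewrite ?inE !negb_or.
    split=> //; apply/andP; split.
    + by rewrite sedge_neq // prev_adj.
    + by move: pR; rewrite !inE negb_or => /andP[].
    + by rewrite eq_sym sedge_neq // next_adj.
    + by move: nR; rewrite !inE negb_or => /andP[].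
  by split; rewrite ?(bypass zc) // eq_sym ?xpv ?xnv.
- by rewrite /walk /= !eqxx !sedge_ore.
- by rewrite /= !inE !negb_or zx' zv' eq_sym xv.
- by rewrite ore_sym sedge_ore.
- move=> y; rewrite !inE => /or3P[]/eqP->; rewrite ?eqxx ?orbT //.
  by rewrite (negPf zc).
Qed.

End Common.
End Attachments.

Section Counting.
Variable G : sgraph.
Local Notation adj := (@sedge G).
Local Notation ore := (@ore_adj G).
Hypothesis claw_heavy : graph_heavy claw G.

Let ore_sym := @ore_adj_sym G.
Let adj_sym := @sedge_sym G.

Lemma has_first (T : Type) (a : pred T) s : has a s ->
  exists s1 x s2, [/\ s = s1 ++ x :: s2, a x & ~~ has a s1].
Proof.
case/split_find => x s1 s2 ax ns.
by exists s1, x, s2; rewrite cat_rcons.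
Qed.

(* Two members of s that are not joined would form a claw with x and z. *)
Lemma star_path x z s : adj x z -> uniq s ->
  {in s, forall y, [/\ adj x y, y != z & ~~ ore z y]} -> path ore x s.
Proof.
move=> xz Us H.
have cl y y' : y \in s -> y' \in s -> y != y' -> ore y y'.
  move=> /H[xy yz zy] /H[xy' yz' zy'] yy'.
  have zny : z != y by rewrite eq_sym.
  have zny' : z != y' by rewrite eq_sym.
  case: (claw_ore claw_heavy xz xy xy' zny zny' yy') => // H1.
    by rewrite H1 in zy.
  by rewrite H1 in zy'.
case: s Us H cl => //= y s /andP[ys Us] H cl.
rewrite sedge_ore /=; last by have [] := H y (mem_head _ _).
elim: s y ys Us cl {H} => //= y' s IH y; rewrite inE negb_or => /andP[yy' ys] /andP[ys' Us] cl.
rewrite cl ?inE ?eqxx ?orbT //=; apply: IH => // a b ai bi; apply: cl.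
  by rewrite inE ai orbT.
by rewrite inE bi orbT.
Qed.

Lemma star_path_rev x z s y : adj x z -> uniq (y :: s) ->
  {in y :: s, forall y, [/\ adj x y, y != z & ~~ ore z y]} -> path ore y (rcons s x).
Proof.
move=> xz Us H.
have : path ore x (rev (y :: s)).
  apply: (star_path xz); first by rewrite rev_uniq.
  by move=> w; rewrite mem_rev => /H.
have := rev_path ore y (rcons s x); rewrite last_rcons belast_rcons => ->.
by rewrite (eq_path (e' := ore)) // => a b; apply: ore_sym.
Qed.

Lemma ore_closed_card u v : ~~ adj u v -> u != v -> #|G| <= degree u + degree v ->
  2 + #|~: ([set y | adj u y] :|: [set y | adj v y] :|: [set u; v])| <=
    #|[set y | adj u y] :&: [set y | adj v y]|.
Proof.
move=> nuv uv; rewrite /degree.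
set Nu := [set y | adj u y]; set Nv := [set y | adj v y] => h.
have e1 := cardsUI Nu Nv.
have e2 := cardsC (Nu :|: Nv :|: [set u; v]).
have := cardsUI (Nu :|: Nv) [set u; v].
rewrite cards2 uv (_ : _ :&: [set u; v] = set0) ?cards0; last first.
  apply/setP => y; rewrite !inE; apply/negP => /andP[H /orP[]/eqP E]; move: H;
  by rewrite E !sedge_irrefl ?orbF ?(negPf nuv) // adj_sym (negPf nuv).
move: e1 e2 h; move: #|_ :|: [set u; v]| #|~: _| #|Nu :|: Nv| #|Nu :&: Nv| #|Nu| #|Nv| #|G|.
by clear; lia.
Qed.

Section Cycle.
Variables (u : G) (p : seq G).
Local Notation c := (u :: p).
Hypothesis cyc : ucycle adj c.
Hypothesis c3 : 2 < size c.
Hypothesis longest : forall s, ucycle ore s -> size s <= size c.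

Let Uc : uniq c. Proof. by case/andP: cyc. Qed.

(* The cycle u mid P1 v Bs P2 As is compared with the cycle u Y P1 v P2. *)
Lemma arc_exchange Y P1 v P2 mid As Bs : p = Y ++ P1 ++ v :: P2 ->
  path ore u (mid ++ rcons P1 v) -> path ore v (Bs ++ P2) ->
  path ore (last v (Bs ++ P2)) (rcons As u) -> uniq mid ->
  {in mid, forall x, x \notin c} -> uniq (As ++ Bs) -> {subset As ++ Bs <= Y} ->
  size mid + size (As ++ Bs) <= size Y.
Proof.
move=> pE h1 h2 h3 Um mc Uab sub.
have /longest : ucycle ore (u :: mid ++ rcons P1 v ++ (Bs ++ P2) ++ As).
  apply/andP; split.
    rewrite /= -cats1 -!catA cats1 catA cat_path h1 last_cat last_rcons /=.
    by rewrite catA cat_path h2.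
  rewrite (perm_uniq (s2 := mid ++ (As ++ Bs) ++ (u :: P1 ++ v :: P2))); last by perm_count.
  have : uniq (Y ++ u :: P1 ++ v :: P2).
    by rewrite -(perm_uniq (s1 := c)) // pE; perm_count.
  rewrite cat_uniq => /and3P[UY /hasPn nY UP].
  rewrite cat_uniq Um /= cat_uniq Uab UP andbT; apply/andP; split; last first.
    by apply/hasPn => x /nY; apply: contra; apply: sub.
  apply/hasPn => x; rewrite mem_cat => xs; apply/negP => /= /mc /negP; apply.
  rewrite pE inE mem_cat; case/orP: xs => [/sub->|]; first by rewrite orbT.
  by rewrite inE => /orP[->//|->]; rewrite !orbT.
rewrite pE [size (u :: mid ++ _)]/= [size (u :: Y ++ _)]/= ltnS.
rewrite !size_cat size_rcons [size (v :: P2)]/=.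
move: (size mid) (size As) (size Bs) (size P1) (size P2) (size Y); clear => *.
by lia.
Qed.

Lemma last_prev : prev c u = last u p.
Proof.
have nl : next c (last u p) = u.
  rewrite -(next_rot (size p) Uc) lastI -[in rot _ _](size_belast u p) -cats1 rot_size_cat.
  by case: (p) => [|x t] /=; rewrite eqxx.
by have := prev_next Uc (last u p); rewrite nl.
Qed.

(* If u v were heavy, then u and v would have at least |D| + 2 common neighbours,
   where D is the set of the other vertices adjacent to neither. Let Y be the arc
   of the cycle strictly between u and the first q that is v, or is joined to z
   and adjacent to u or v. Replace Y by the common neighbours W off the cycle and
   put the neighbours of u and of v in Y back: as no longer cycle exists, at least
   |W| members of Y belong to D. A common neighbour on the cycle contributes its
   successor to D. *)
Lemma common_not_heavy v z : v \in p -> z \notin c -> adj z u -> adj z v ->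
  ~~ adj u v -> ~~ ore u v.
Proof.
move=> vp zc zu zv nuv; apply/negP; rewrite /ore_adj (negPf nuv) /= => heavy.
have uc : u \in c by exact: mem_head.
have vc : v \in c by rewrite inE vp orbT.
have uv : u != v by apply: contraTneq vp => <-; case/andP: Uc.
have := ore_closed_card nuv uv heavy.
set D := ~: _; set N := _ :&: _ => cardN.
have cn x := @common_neighbour _ claw_heavy _ cyc c3 longest z zc u v x uc vc zu zv uv.
have [a1 a2 a3 a4] := attached_apart cyc longest zc uc vc zu zv.
pose lam q := (q == v) || ((adj u q || adj v q) && ore z q).
have [|Y [q [P [pE lq nY]]]] := @has_first _ lam p.
  by apply/hasP; exists v => //; rewrite /lam eqxx.
have nlam y : y \in Y -> ~~ lam y by move/hasPn: nY; apply.
have vP : v \in q :: P.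
  move: vp; rewrite pE mem_cat => /orP[/nlam|//].
  by rewrite /lam eqxx.
have [P1 [P2 PE]] : exists P1 P2, q :: P = P1 ++ v :: P2.
  by case/splitPr: vP => P1 P2; exists P1, P2.
have pE' : p = Y ++ P1 ++ v :: P2 by rewrite pE PE.
case: P2 PE pE' => [|v1 P2] PE pE'.
  by move: a2; rewrite last_prev // pE' !last_cat /= eqxx.
have nv : next c v = v1.
  have cE : c = (u :: Y ++ P1) ++ [:: v, v1 & P2] by rewrite pE' /= catA.
  by rewrite cE next_mid // -cE.
have adjc : path adj u (rcons p u) by case/andP: cyc.
pose W := N :\: [set x in c].
have zW : z \in W by rewrite !inE /= adj_sym zu adj_sym zv negb_or; move: zc; rewrite inE negb_or => ->.
pose Wl := rcons (enum (W :\ z)) z.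
have UWl : uniq Wl by rewrite rcons_uniq enum_uniq mem_enum !inE eqxx.
have WlE x : (x \in Wl) = (x \in W).
  by rewrite mem_rcons inE mem_enum in_setD1; case: eqP => // ->; rewrite zW.
have sWl : size Wl = #|W|.
  by rewrite size_rcons -cardE [in RHS](cardsD1 z) zW add1n.
have WP x : x \in W -> [/\ x \notin c, adj u x & adj v x].
  by rewrite 4!inE => /andP[xc]; rewrite !inE => /andP[].
pose As := [seq y <- Y | adj u y]; pose Bs := [seq y <- Y | adj v y].
have UY : uniq Y by move: Uc; rewrite pE /= cat_uniq => /and4P[].
have Yc y : y \in Y -> y \in c by move=> yY; rewrite pE inE mem_cat yY orbT.
have notboth y : y \in Y -> adj u y -> adj v y -> False.
  move=> yY uy vy; have [zy _ _ _] := cn y (Yc _ yY) uy vy.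
  by case/negP: (nlam _ yY); rewrite /lam uy zy orbT.
have sz : size Wl + size (As ++ Bs) <= size Y.
  apply: (arc_exchange pE').
  - rewrite cat_path; apply/andP; split.
      apply: (star_path (next_adj cyc uc)) => // y; rewrite WlE => /WP[yc uy vy].
      split=> //; first by apply: contraNneq yc => ->; rewrite mem_next.
      by rewrite ore_sym; apply: (attach_next cyc longest) => //; rewrite sedge_ore // adj_sym.
    rewrite last_rcons.
    have : path adj u (Y ++ q :: P) by move: adjc; rewrite -cats1 cat_path -pE => /andP[].
    rewrite PE cat_path -cat_rcons cat_path => /and3P[_ p1 _].
    have zq : ore z q.
      by move: lq => /orP[/eqP->|/andP[]//]; exact: sedge_ore.
    case: (P1) PE p1 => [|q' P1'] /= [<- _] /andP[_ p1] /=; first by rewrite zq.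
    by rewrite zq; apply: sub_path p1; exact: sedge_ore.
  - have : path adj v (v1 :: P2).
      move: adjc; rewrite pE' -cats1 cat_path => /andP[+ _].
      by rewrite catA cat_path => /andP[_ /=/andP[]].
    move=> /= /andP[vv1 vP2].
    rewrite -cat_rcons cat_path last_rcons; apply/andP; split; last first.
      by apply: sub_path vP2; exact: sedge_ore.
    apply: (star_path (x := v) (z := z)); first by rewrite adj_sym.
      rewrite rcons_uniq filter_uniq // andbT mem_filter negb_and; apply/orP; right.
      move: Uc; rewrite pE' /= cat_uniq => /and4P[_ _ /hasPn H _]; apply: H.
      by rewrite mem_cat !inE eqxx !orbT.
    move=> y; rewrite mem_rcons inE mem_filter => /orP[/eqP->|/andP[vy yY]].
      split=> //; first by apply: contraNneq zc => <-; rewrite -nv mem_next.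
      by rewrite -nv; apply: (attach_next cyc longest) => //; exact: sedge_ore.
    split=> //; first by apply: contraNneq zc => <-; exact: Yc.
    by apply: contraNN (nlam _ yY) => zy; rewrite /lam vy zy !orbT.
  - have -> : last v (Bs ++ v1 :: P2) = prev c u.
      by rewrite last_prev // pE' !last_cat.
    apply: (star_path_rev (z := z)); first by rewrite adj_sym.
      rewrite cons_uniq filter_uniq // andbT mem_filter negb_and; apply/orP; right.
      rewrite last_prev // pE' !last_cat /=.
      move: Uc; rewrite pE' /= cat_uniq => /and4P[_ _ /hasPn H _]; apply: H.
      by rewrite mem_cat in_cons mem_last !orbT.
    move=> y; rewrite inE mem_filter => /orP[/eqP->|/andP[uy yY]].
      split; first by rewrite adj_sym prev_adj.
        by apply: contraNneq zc => <-; rewrite mem_prev.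
      by apply: (attach_prev cyc longest) => //; exact: sedge_ore.
    split=> //; first by apply: contraNneq zc => <-; exact: Yc.
    by apply: contraNN (nlam _ yY) => zy; rewrite /lam uy zy !orbT.
  - exact: UWl.
  - by move=> x; rewrite WlE => /WP[].
  - rewrite cat_uniq !filter_uniq // andbT; apply/hasPn => y.
    by rewrite mem_filter => /andP[vy yY]; rewrite mem_filter yY andbT; apply/negP => /(notboth _ yY)/(_ vy).
  - by move=> y; rewrite mem_cat !mem_filter => /orP[]/andP[].
pose DY := [seq y <- Y | ~~ (adj u y || adj v y)].
have sDY : size Y <= size (As ++ Bs) + size DY.
  rewrite size_cat !size_filter -(count_predUI (adj u) (adj v) Y).
  have -> : count (predI (adj u) (adj v)) Y = 0.
    apply/eqP; rewrite -leqn0 leqNgt -has_count; apply/hasPn => y yY.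
    by apply/negP => /= /andP[uy]; apply: notboth uy.
  rewrite addn0 -(count_predC (predU (adj u) (adj v)) Y).
  by rewrite leq_add2l; apply: sub_count.
pose T := N :&: [set x in c].
have TP x : x \in T -> [/\ x \in c, adj u x & adj v x].
  by rewrite /T /N !inE => /andP[/andP[ux vx] xc]; split; rewrite ?inE.
pose DT := [seq next c x | x <- enum T].
have sDT : size DT = #|T| by rewrite size_map -cardE.
have := cardsID [set x in c] N; rewrite -/W -/T.
have : size (DY ++ DT) <= #|D|.
  rewrite cardE; apply: uniq_leq_size.
    rewrite cat_uniq filter_uniq // map_inj_uniq ?enum_uniq ?andbT /=; last first.
      exact: (can_inj (prev_next Uc)).
    apply/hasPn => y /mapP[x]; rewrite mem_enum => /TP[xc ux vx] yE; apply/negP => /=.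
    rewrite mem_filter => /andP[_ yY].
    have xE : prev c y = x by rewrite yE prev_next.
    have : x \in u :: Y.
      move: xE; case/splitPr: yY pE => Y1 Y2 pE1.
      have cE : c = belast u Y1 ++ [:: last u Y1, y & Y2 ++ q :: P].
        by rewrite -[RHS]cat_rcons -lastI pE1 -catA.
      rewrite cE prev_mid -?cE // => <-.
      have := mem_last u Y1; rewrite !inE mem_cat => /orP[->//|->].
      by rewrite orbT.
    rewrite inE => /orP[/eqP xu|xY]; first by rewrite xu sedge_irrefl in ux.
    exact: (notboth _ xY ux vx).
  move=> y; rewrite mem_enum mem_cat mem_filter !inE => /orP[/andP[nb yY]|/mapP[x]].
    rewrite !negb_or in nb *; rewrite nb /=; apply/andP; split.
      by apply: contraTneq Uc => <-; rewrite pE /= mem_cat yY.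
    by apply: contraTneq (nlam _ yY) => ->; rewrite /lam eqxx.
  rewrite mem_enum => /TP[xc ux vx] ->.
  have [_ n1 n2] := cn x xc ux vx.
  by rewrite !inE !negb_or n1 n2.
rewrite (size_cat DY DT); move: sz sDY sDT sWl cardN.
move: (size (As ++ Bs)) (size DY) (size DT) (size Wl) (size Y) #|D| #|N| #|T| #|W|.
by clear; lia.
Qed.

(* The counting of [common_not_heavy] for the second vertex w of an ear. Only one
   common neighbour of u and w lies on the cycle, and only the neighbours of u in
   Y are put back. *)
Lemma far_not_heavy v z w z' R : v \in p -> z \notin c -> w \notin c ->
  adj z u -> adj z w -> ~~ adj u w ->
  (forall y a b, y \notin c -> a \in c -> b \in c -> adj y a -> adj y b -> a = b) ->
  walk adj w z' R -> adj z' v -> uniq R ->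
  {in R, forall y, y \notin c /\ ~~ adj u y} -> ~~ ore u w.
Proof.
move=> vp zc wc zu zw nuw one wR z'v UR HR.
apply/negP; rewrite /ore_adj (negPf nuw) /= => heavy.
have uc : u \in c by exact: mem_head.
have uw : u != w by apply: contraNneq wc => <-.
have := ore_closed_card nuw uw heavy.
set D := ~: _; set N := _ :&: _ => cardN.
pose lam q := [|| q == v, adj w q | adj u q && ore z q].
have [|Y [q [P [pE lq nY]]]] := @has_first _ lam p.
  by apply/hasP; exists v => //; rewrite /lam eqxx.
have nlam y : y \in Y -> ~~ lam y by move/hasPn: nY; apply.
have adjc : path adj u (rcons p u) by case/andP: cyc.
pose W := N :\: [set x in c].
have zW : z \in W by rewrite !inE /= adj_sym zu adj_sym zw negb_or; move: zc; rewrite inE negb_or => ->.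
pose Wl := rcons (enum (W :\ z)) z.
have UWl : uniq Wl by rewrite rcons_uniq enum_uniq mem_enum !inE eqxx.
have WlE x : (x \in Wl) = (x \in W).
  by rewrite mem_rcons inE mem_enum in_setD1; case: eqP => // ->; rewrite zW.
have sWl : size Wl = #|W|.
  by rewrite size_rcons -cardE [in RHS](cardsD1 z) zW add1n.
have WP x : x \in W -> [/\ x \notin c, adj u x & adj w x].
  by rewrite 4!inE => /andP[xc]; rewrite !inE => /andP[].
have pW : path ore u Wl.
  apply: (star_path (next_adj cyc uc)) => // y; rewrite WlE => /WP[yc uy vy].
  split=> //; first by apply: contraNneq yc => ->; rewrite mem_next.
  by rewrite ore_sym; apply: (attach_next cyc longest) => //; rewrite sedge_ore // adj_sym.
have lW : last u Wl = z by rewrite last_rcons.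
have ww : walk ore u z (u :: Wl) by rewrite -lW; apply: walk_path.
have [mid [m1 m2 m3 m4]] : exists mid, [/\ path ore u (rcons mid q), uniq mid,
    {in mid, forall x, x \notin c} & size Wl <= size mid].
  have Wc : {in Wl, forall x, x \notin c} by move=> x; rewrite WlE => /WP[].
  have zw' := sedge_ore zw.
  have toq e mid : walk ore u e (u :: mid) -> ore e q -> path ore u (rcons mid q).
    by move=> /and3P[_ pm /eqP le] eq; rewrite rcons_path pm le.
  case/or3P: lq => [/eqP qv|wq|/andP[_ zq]].
  - have wR' : walk ore w z' R.
      case: (R) wR => // y s /and3P[yw ys ls]; rewrite /walk yw ls andbT /=.
      by apply: sub_path ys; exact: sedge_ore.
    exists (Wl ++ R); split.
    + by apply: toq (walk_cat ww zw' wR') _; rewrite qv sedge_ore.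
    + rewrite cat_uniq UWl UR andbT; apply/hasPn => y /HR[_ uy] /=.
      by rewrite WlE; apply: contraNN uy => /WP[].
    + by move=> y; rewrite mem_cat => /orP[/Wc|/HR[]].
    + by rewrite size_cat leq_addr.
  - exists (rcons Wl w); split.
    + by apply: toq (walk_rcons ww zw') _; rewrite sedge_ore.
    + rewrite rcons_uniq UWl andbT WlE; apply: contraNN nuw => /WP[_ _].
      by rewrite sedge_irrefl.
    + by move=> y; rewrite mem_rcons inE => /orP[/eqP->|/Wc].
    + by rewrite (size_rcons Wl) leqnSn.
  - by exists Wl; split; [exact: (toq z) | exact: UWl | exact: Wc | exact: leqnn].
pose As := [seq y <- Y | adj u y].
have UY : uniq Y by move: Uc; rewrite pE /= cat_uniq => /and4P[].
have Yc y : y \in Y -> y \in c by move=> yY; rewrite pE inE mem_cat yY orbT.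
have sz : size mid + size (As ++ [::]) <= size Y.
  apply: (@arc_exchange Y [::] q P) => //; rewrite ?cats0 ?cats1 //.
  - move: adjc; rewrite pE -cats1 -catA cat_path /= => /and3P[_ _].
    by rewrite cat_path => /andP[qP _]; apply: sub_path qP; exact: sedge_ore.
  - have -> : last q ([::] ++ P) = prev c u.
      by rewrite last_prev // pE !last_cat.
    apply: (star_path_rev (z := z)); first by rewrite adj_sym.
      rewrite cons_uniq filter_uniq // andbT mem_filter negb_and; apply/orP; right.
      rewrite last_prev // pE !last_cat /=.
      move: Uc; rewrite pE /= cat_uniq => /and4P[_ _ /hasPn H _]; apply: H.
      by rewrite mem_last.
    move=> y; rewrite inE mem_filter => /orP[/eqP->|/andP[uy yY]].
      split; first by rewrite adj_sym prev_adj.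
        by apply: contraNneq zc => <-; rewrite mem_prev.
      by apply: (attach_prev cyc longest) => //; exact: sedge_ore.
    split=> //; first by apply: contraNneq zc => <-; exact: Yc.
    by apply: contraNN (nlam _ yY) => zy; rewrite /lam uy zy !orbT.
  - by rewrite filter_uniq.
  - by move=> y; rewrite mem_filter => /andP[].
pose DY := [seq y <- Y | ~~ adj u y].
have sDY : size As + size DY = size Y.
  by rewrite !size_filter -(count_predC (adj u) Y).
have DYD : size DY <= #|D|.
  rewrite cardE; apply: uniq_leq_size; first by rewrite filter_uniq.
  move=> y; rewrite mem_filter mem_enum !inE => /andP[nuy yY].
  have := nlam _ yY; rewrite /lam !negb_or nuy => /and3P[_ -> _] /=.
  apply/andP; split; first by apply: contraTneq Uc => <-; rewrite pE /= mem_cat yY.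
  by apply: contraNneq wc => <-; exact: Yc.
have T1 : #|N :&: [set x in c]| <= 1.
  apply/card_le1_eqP => a b; rewrite /N !inE.
  move=> /andP[/andP[_ wa] ac] /andP[/andP[_ wb] bc].
  by apply: (one w) => //; rewrite inE.
have := cardsID [set x in c] N; rewrite -/W.
move: sz sDY DYD T1 sWl cardN m4; rewrite cats0.
move: (size mid) (size As) (size DY) (size Wl) (size Y) #|D| #|N| #|_ :&: _| #|W|.
by clear; lia.
Qed.

End Cycle.
End Counting.

Section OneClean.
Variable G : sgraph.
Local Notation adj := (@sedge G).
Local Notation ore := (@ore_adj G).

Definition clean (s : seq G) := {in s &, forall x y, x != y -> ore x y -> adj x y}.

Lemma cleanPn (s : seq G) : clean s \/
  exists x y, [/\ x \in s, y \in s, x != y & #|G| <= degree x + degree y].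
Proof.
case: (boolP (all (fun x => all (fun y => [|| x == y, ~~ ore x y | adj x y]) s) s)) => [/allP H|].
  left=> x y xs ys xy oxy; have /allP/(_ y ys) := H x xs.
  by rewrite (negPf xy) oxy.
case/allPn => x xs /allPn[y ys] /=; rewrite negb_or => /andP[xy].
rewrite negb_or => /andP[/negPn oxy nxy].
by right; exists x, y; split=> //; move: oxy; rewrite /ore_adj (negPf nxy).
Qed.

Lemma exchange_sums n i j k l : n <= i + j -> n <= k + l -> n <= i + k \/ n <= j + l.
Proof. by move=> h1 h2; case: (leqP n (i + k)) => ?; [left | right]; lia. Qed.

(* Two heavy pairs, one in each blob, would by an exchange of summands give two
   cross adjacencies with a common end, but by [cross] these form a matching. *)
Lemma one_blob_clean (u v x1 y1 x2 y2 z z' : G) f b g h S1 S2 Q :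
  conf ore u f b v g h x1 y1 S1 x2 y2 S2 z z' Q -> ore z' v ->
  uniq ((u :: f ++ b) ++ (v :: g ++ h)) ->
  clean (u :: f ++ b) \/ clean (v :: g ++ h).
Proof.
move=> cf zv U.
have cr s t : s \in u :: f ++ b -> t \in v :: g ++ h -> #|G| <= degree s + degree t -> _ :=
  fun sI tJ st => cross (@ore_adj_sym G) cf zv sI tJ (introT orP (or_intror st)).
have heads (w : G) (k l : seq G) : uniq (w :: k ++ l) -> blob ore w k l ->
    [/\ w != head w k, w != head w l & head w k != head w l].
  rewrite cons_uniq mem_cat negb_or cat_uniq => /andP[/andP[wk wl]] /and3P[_ /hasPn kl _].
  move=> /blob_arms[ek el].
  have hk : head w k \in k by rewrite {2}ek mem_head.
  have hl : head w l \in l by rewrite {2}el mem_head.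
  split; first by apply: contraNneq wk => ->.
    by apply: contraNneq wl => ->.
  by apply: contraTneq hk => ->; apply: kl.
have [Uu Uv] : uniq (u :: f ++ b) /\ uniq (v :: g ++ h).
  by move: U; rewrite cat_uniq => /and3P[].
have [uL uK LK] := heads _ _ _ Uu (cf_u cf).
have [vL vK LK'] := heads _ _ _ Uv (cf_v cf).
have [|[a [c [aI cI ac hac]]]] := cleanPn (u :: f ++ b); first by left.
have [|[a' [c' [aJ cJ ac' hac']]]] := cleanPn (v :: g ++ h); first by right.
pose M s t := [\/ s = u /\ t = v, s = head u f /\ t = head v g | s = head u b /\ t = head v h].
have Ml s t t' : M s t -> M s t' -> t = t'.
  by case=> -[-> ->] [] [/eqP E ->] //; move: E;
  rewrite 1?eq_sym ?(negPf uL) ?(negPf uK) ?(negPf LK) // eq_sym ?(negPf uL) ?(negPf uK) ?(negPf LK).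
have Mr s s' t : M s t -> M s' t -> s = s'.
  by case=> -[-> ->] [] [-> /eqP E] //; move: E;
  rewrite 1?eq_sym ?(negPf vL) ?(negPf vK) ?(negPf LK') // eq_sym ?(negPf vL) ?(negPf vK) ?(negPf LK').
have tot s t : s \in u :: f ++ b -> t \in v :: g ++ h -> #|G| <= degree s + degree t -> M s t.
  exact: cr.
have [H1|H1] := exchange_sums hac hac'.
all: rewrite addnC in hac'; have [H2|H2] := exchange_sums hac hac'.
- by rewrite (Ml _ _ _ (tot _ _ aI aJ H1) (tot _ _ aI cJ H2)) eqxx in ac'.
- by rewrite (Mr _ _ _ (tot _ _ aI aJ H1) (tot _ _ cI aJ H2)) eqxx in ac.
- by rewrite (Mr _ _ _ (tot _ _ aI cJ H2) (tot _ _ cI cJ H1)) eqxx in ac.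
- by rewrite (Ml _ _ _ (tot _ _ cI aJ H2) (tot _ _ cI cJ H1)) eqxx in ac'.
Qed.

End OneClean.

Section Assembly.
Variable G : sgraph.
Local Notation adj := (@sedge G).
Local Notation ore := (@ore_adj G).

Let ore_sym := @ore_adj_sym G.
Let adj_sym := @sedge_sym G.

Lemma last_rev (T : Type) (x : T) s : last x (rev s) = head x s.
Proof. by case: s => //= y s; rewrite rev_cons last_rcons. Qed.

(* X and Y list the vertices met when leaving w in the two directions. *)
Lemma grow_blob (w : G) X Y :
  path adj w X -> path adj w Y ->
  (forall f b X' Y', X = rev f ++ X' -> Y = rev b ++ Y' -> blob ore w f b ->
     X' <> [::] /\ Y' <> [::]) ->
  (exists x X' y Y', [/\ X = x :: X', Y = y :: Y' & ore x y]) ->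
  exists f b x X' y Y', [/\ X = rev f ++ x :: X', Y = rev b ++ y :: Y',
    blob ore w f b & maximal_blob w f b x y].
Proof.
move=> pX pY ne [x0 [X0 [y0 [Y0 [EX EY xy0]]]]].
suff grow n f b X' Y' : size X' + size Y' < n -> X = rev f ++ X' -> Y = rev b ++ Y' ->
    blob ore w f b -> exists f b x X' y Y', [/\ X = rev f ++ x :: X',
    Y = rev b ++ y :: Y', blob ore w f b & maximal_blob w f b x y].
  apply: (grow _ [:: x0] [:: y0] X0 Y0 (ltnSn _)) => //.
  apply: blob_base => //.
    by move: pX; rewrite EX /= => /andP[/sedge_ore].
  by move: pY; rewrite EY /= => /andP[/sedge_ore].
elim: n f b X' Y' => // n IH f b X' Y' sn fX bY bl.
have [] := ne _ _ _ _ fX bY bl.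
case: X' fX sn => [//|x X'] fX sn _; case: Y' bY sn => [//|y Y'] bY sn _.
have [small1 small2 small3] : [/\ size X' + size (y :: Y') < n,
    size (x :: X') + size Y' < n & size X' + size Y' < n].
  move: sn; rewrite -[size (x :: X')]/(size X').+1 -[size (y :: Y')]/(size Y').+1.
  by move: (size X') (size Y'); clear => i j ij; split; lia.
have [pf Lx] : path adj w (rev f) /\ adj (head w f) x.
  by move: pX; rewrite fX cat_path last_rev /= => /and3P[].
have [pb Ky] : path adj w (rev b) /\ adj (head w b) y.
  by move: pY; rewrite bY cat_path last_rev /= => /and3P[].
have [Ef Eb] := blob_arms bl.
case: (boolP (has (ore x) (w :: behead f ++ b))) => [/hasP[s sI xs]|/hasPn n1].
  apply: (IH (x :: f) b X' (y :: Y')); rewrite ?rev_cons ?cat_rcons //.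
  rewrite Ef; by apply: (blob_left (s := s)); rewrite -?Ef // sedge_ore.
case: (boolP (has (ore y) (w :: f ++ behead b))) => [/hasP[s sI ys]|/hasPn n2].
  apply: (IH f (y :: b) (x :: X') Y'); rewrite ?rev_cons ?cat_rcons //.
  rewrite Eb; by apply: (blob_right (s := s)); rewrite -?Eb // sedge_ore.
case: (boolP (ore x y)) => n3.
  apply: (IH (x :: f) (y :: b) X' Y'); rewrite ?rev_cons ?cat_rcons //.
  rewrite Ef Eb; by apply: blob_both; rewrite -?Ef -?Eb // sedge_ore.
by exists f, b, x, X', y, Y'; split=> //; split.
Qed.

Section Two_connected.
Hypothesis conn2 : k_connected 2 G.

Lemma path_avoiding w x y : x != w -> y != w ->
  exists p, [/\ path adj x p, last x p = y & w \notin x :: p].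
Proof.
move=> xw yw; case: conn2 => _ /(_ [set w]); rewrite cards1 => /(_ isT) cn.
have xA : x \in ~: [set w] by rewrite !inE.
have yA : y \in ~: [set w] by rewrite !inE.
have /connectP[p pp lp] := cn (exist _ x xA) (exist _ y yA).
set x' : {x : G | x \in ~: [set w]} := exist _ x xA in pp lp *.
exists (map val p); split.
- by rewrite -[x]/(val x') path_map.
- by rewrite -[x]/(val x') last_map -lp.
- rewrite -[x]/(val x') -map_cons.
  by apply/mapP => -[[t tA] _ /= E]; move: (tA); rewrite !inE -E eqxx.
Qed.

Lemma some_path x y : exists2 p, path adj x p & last x p = y.
Proof.
have [n3 _] := conn2.
have : 0 < #|~: [set x; y]|.
  have := cardsC [set x; y]; rewrite cards2; move: n3.
  by case: (x != y); move: #|~: _| #|G|; clear => *; lia.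
case/card_gt0P => w; rewrite !inE negb_or => /andP[wx wy].
have [||p [pp lp _]] := @path_avoiding w x y; rewrite 1?eq_sym //.
by exists p.
Qed.

Definition ear (c : seq G) u v R :=
  [&& u \in c, v \in c, u != v, path adj u (rcons R v), all (predC (mem c)) R & 0 < size R].

Lemma ear_exists (c : seq G) u1 u2 t : u1 \in c -> u2 \in c -> u1 != u2 -> t \notin c ->
  exists u v R, ear c u v R.
Proof.
move=> u1c u2c u12 tc.
have [p pp lp] := some_path t u1.
have [|z [u [_ _ zu zc uc]]] := @path_first _ adj (mem c) t p pp tc; first by rewrite lp.
have [u' u'c u'u] : exists2 u', u' \in c & u' != u.
  by case: (eqVneq u1 u) => [<-|?]; [exists u2; rewrite 1?eq_sym | exists u1].
have zu' : z != u by apply: contraNneq zc => ->.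
have [q [qp lq uq]] := path_avoiding zu' u'u.
have [|R1 [v [s2 [qE vc nR]]]] := @has_first _ (mem c) q.
  apply/hasP; exists u' => //; rewrite -lq; case: (q) lq => [/= E|y s] /=; last by rewrite mem_last.
  by move: zc; rewrite E /= u'c.
have [uc' vc' zc'] : [/\ u \in c, v \in c & z \notin c] by [].
exists u, v, (z :: R1); rewrite /ear uc' vc' /= adj_sym zu zc' andbT /=.
apply/and3P; split.
- by apply: contraNneq uq => ->; rewrite qE inE mem_cat mem_head !orbT.
- by move: qp; rewrite qE -cat_rcons cat_path => /andP[].
- by rewrite all_predC.
Qed.

Lemma ear_uniq c u v R : ear c u v R ->
  exists R', [/\ ear c u v R', uniq R' & size R' <= size R].
Proof.
move=> /and5P[uc vc uv pR /andP[aR]]; case: R pR aR => // z R1 /= /andP[uz].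
rewrite rcons_path => /andP[zR1 lv] /andP[zc aR] _.
case: (shortenP zR1) lv => p' zp' Up' sub lv.
exists (z :: p'); split=> //; last first.
  have sub' : {subset z :: p' <= z :: R1}.
    by move=> y; rewrite !inE => /orP[->//|/sub->]; rewrite orbT.
  exact: uniq_leq_size Up' sub'.
rewrite /ear uc vc uv /= uz rcons_path zp' lv zc andbT /=.
by rewrite ?andbT; apply/allP => y /sub /(allP aR).
Qed.

Lemma cycle_exists : exists2 c, ucycle adj c & 2 < size c.
Proof.
have [n3 _] := conn2.
have [x _] : exists x, x \in [set: G] by apply/card_gt0P; rewrite cardsT; apply: leq_ltn_trans n3.
have [y xy] : exists y, y != x.
  have : 0 < #|~: [set x]| by have := cardsC1 x; move: n3; move: #|_| #|~: _|; clear => *; lia.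
  by case/card_gt0P => y; rewrite !inE; exists y.
have [p pp lp] := some_path x y.
have [a xa] : exists a, adj x a.
  case: p pp lp => [|a s] /=; first by move=> _ E; rewrite E eqxx in xy.
  by move=> /andP[? _] _; exists a.
have ax := sedge_neq xa.
have : 0 < #|~: [set x; a]|.
  have := cardsC [set x; a]; rewrite cards2; move: n3.
  by case: (x != a); move: #|~: _| #|G|; clear => *; lia.
case/card_gt0P => t; rewrite in_setC in_set2 => tc.
have [||||u [v [R]]] := @ear_exists [:: x; a] x a t; rewrite ?mem_head ?inE ?eqxx ?orbT //.
case/ear_uniq => R' [/and5P[uc vc uv pR /andP[aR sR]] UR _].
have uva : adj v u.
  by move: uc vc uv; rewrite !inE => /orP[]/eqP-> /orP[]/eqP->; rewrite ?eqxx // adj_sym.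
exists (u :: rcons R' v); last by rewrite /= size_rcons !ltnS.
apply/andP; split; first by rewrite /= rcons_path pR last_rcons.
have nR w : w \in [:: x; a] -> w \notin R' by move=> wc; apply/negP => /(allP aR); rewrite /= wc.
by rewrite /= rcons_uniq mem_rcons inE negb_or uv UR !nR.
Qed.

End Two_connected.
End Assembly.

Section LongestCycle.
Variable G : sgraph.
Local Notation adj := (@sedge G).
Local Notation ore := (@ore_adj G).
Hypothesis claw_heavy : graph_heavy claw G.
Hypothesis N112_heavy : graph_heavy N112 G.
Hypothesis deer_heavy : graph_heavy deer G.
Variable c : seq G.
Hypothesis cyc : ucycle adj c.
Hypothesis c3 : 2 < size c.
Hypothesis longest : forall s, ucycle ore s -> size s <= size c.

Let ore_sym := @ore_adj_sym G.
Let adj_sym := @sedge_sym G.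
Let Uc : uniq c. Proof. by case/andP: cyc. Qed.

Record two_blobs u f b v g h x1 y1 S1 x2 y2 S2 : Prop := TwoBlobs {
  tb_u : blob ore u f b;
  tb_v : blob ore v g h;
  tb_S1 : walk ore x1 y1 S1;
  tb_S2 : walk ore x2 y2 S2;
  tb_c : perm_eq c ((u :: f ++ b) ++ (v :: g ++ h) ++ S1 ++ S2);
  tb_mu : maximal_blob u f b x1 x2;
  tb_mv : maximal_blob v g h y1 y2 }.

Lemma two_blobs_swap u f b v g h x1 y1 S1 x2 y2 S2 :
  two_blobs u f b v g h x1 y1 S1 x2 y2 S2 ->
  two_blobs v g h u f b y1 x1 (rev S1) y2 x2 (rev S2).
Proof.
move=> [tu tv t1 t2 tc mu mv]; split=> //; try exact: walk_rev.
by apply: perm_trans tc _; perm_count.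
Qed.

Lemma no_cover a d q R : R <> [::] -> uniq R -> {in R, forall y, y \notin c} ->
  walk ore a d q -> ore d a -> perm_eq q (c ++ R) -> False.
Proof.
move=> R0 UR Rc wq da pq.
have /longest : ucycle ore q.
  apply/andP; split; first exact: walk_cycle wq da.
  rewrite (perm_uniq pq) cat_uniq Uc UR andbT; apply/hasPn => y /Rc.
  by [].
rewrite (perm_size pq) size_cat -{2}[size c]addn0 leq_add2l leqn0 size_eq0.
by move=> /eqP.
Qed.

Lemma two_blobs_conf u f b v g h x1 y1 S1 x2 y2 S2 z z' Q :
  two_blobs u f b v g h x1 y1 S1 x2 y2 S2 ->
  walk ore z z' Q -> uniq Q -> {in Q, forall y, y \notin c} -> ore u z ->
  conf ore u f b v g h x1 y1 S1 x2 y2 S2 z z' Q.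
Proof.
move=> [tu tv t1 t2 tc mu mv] wQ UQ Qc uz; split=> //.
- split=> //; first by apply: sedge_ore; case: (mb_f mu).
  by rewrite ore_sym; apply: sedge_ore; case: (mb_f mv).
- split=> //; first by apply: sedge_ore; case: (mb_b mu).
  by rewrite ore_sym; apply: sedge_ore; case: (mb_b mv).
move=> p a d wp da pp; have Q0 : Q <> [::] by move=> Q0; rewrite Q0 in wQ.
by apply: no_cover Q0 UQ Qc wp da _; perm_count.
Qed.

Lemma ear_rev u v R : ear c u v R -> ear c v u (rev R).
Proof.
rewrite /ear size_rev all_rev eq_sym => /and5P[-> -> -> pR ->]; rewrite andbT /=.
have := rev_path adj u (rcons R v); rewrite last_rcons belast_rcons rev_cons => E.
by rewrite E (eq_path (e' := adj)) // => x y; apply: adj_sym.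
Qed.

Lemma clean_blob_false u f b v g h x1 y1 S1 x2 y2 S2 R :
  two_blobs u f b v g h x1 y1 S1 x2 y2 S2 -> ear c u v R -> uniq R ->
  (forall u' v' R', ear c u' v' R' -> size R <= size R') ->
  clean (u :: f ++ b) -> False.
Proof.
move=> tb eR UR minR cl.
have /and5P[uc vc uv pR /andP[aR sR]] := eR.
have Rc y : y \in R -> y \notin c by move/(allP aR).
case: R eR UR minR pR aR sR Rc => // z R eR UR minR.
rewrite /= => /andP[uz zR] aR _ Rc.
have zc : z \notin c by apply: Rc; exact: mem_head.
have U := perm_uniq (tb_c tb); rewrite Uc in U.
have Ublobs : uniq ((u :: f ++ b) ++ (v :: g ++ h)).
  by move: U; rewrite catA cat_uniq => /esym/andP[].
have mc := perm_mem (tb_c tb).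
have I_c s : s \in u :: f ++ b -> s \in c by move=> sI; rewrite mc mem_cat sI.
have outside : [/\ x1 \notin u :: f ++ b, x2 \notin u :: f ++ b & z \notin u :: f ++ b].
  move: (esym U); rewrite cat_uniq => /and3P[_ /hasPn nI _]; split.
  - by apply: nI; rewrite !mem_cat (walk_mem1 (tb_S1 tb)) orbT.
  - by apply: nI; rewrite !mem_cat (walk_mem1 (tb_S2 tb)) !orbT.
  - by apply: contraNN zc; apply: I_c.
have cf : conf ore u f b v g h x1 y1 S1 x2 y2 S2 z z [:: z].
  apply: two_blobs_conf tb (walk1 _ _) _ _ (sedge_ore uz) => //.
  by move=> y; rewrite inE => /eqP->.
have mu := tb_mu tb; have mv := tb_mv tb.
have [i p cE] := rot_to uc.
have cyc' : ucycle adj (u :: p).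
  by rewrite -cE; move: cyc; rewrite /ucycle rot_cycle rot_uniq.
have longest' s : ucycle ore s -> size s <= size (u :: p) by rewrite -cE size_rot; apply: longest.
have c3' : 2 < size (u :: p) by rewrite -cE size_rot.
have inc' y : (y \in u :: p) = (y \in c) by rewrite -cE mem_rot.
have vp : v \in p by have := inc' v; rewrite vc inE eq_sym (negPf uv).
have zu : adj z u by rewrite adj_sym.
case: R eR UR minR zR aR Rc => [|w R] eR UR minR.
  rewrite /= andbT => zv _ _; have zv' := sedge_ore zv.
  case: (boolP (adj u v)) => auv.
    exact: (no_triangle_through_z claw_heavy N112_heavy deer_heavy cf Ublobs outside mu uz cl zv auv mv).
  have nuv : ~~ ore u v.
    by apply: (common_not_heavy claw_heavy cyc' c3' longest' vp (z := z)); rewrite ?inc' // adj_sym.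
  apply: (no_long_leg claw_heavy N112_heavy cf Ublobs outside mu uz cl zv nuv).
  - move=> s; rewrite mem_cat => /orP[] sI; apply/negP.
      exact: (v_left ore_sym cf zv').
    exact: (v_left ore_sym (conf_mirror ore_sym cf) zv').
  - by apply/negP; exact: (v_x1 ore_sym cf zv').
  - by apply/negP; exact: (v_x1 ore_sym (conf_mirror ore_sym cf) zv').
move=> /= /andP[zw wR] aR Rc.
have wc : w \notin c by apply: Rc; rewrite !inE eqxx orbT.
have nuw y : y \in w :: R -> ~~ adj u y.
  move=> yR; apply/negP => uy.
  have [R1 [R2 E]] : exists R1 R2, w :: R = R1 ++ y :: R2.
    by case/splitPr: yR => R1 R2; exists R1, R2.
  have := minR u v (y :: R2); rewrite /ear uc vc uv /= uy.
  have : path adj z (rcons (w :: R) v) by rewrite /= zw.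
  rewrite E rcons_cat cat_path /= => /and3P[_ _ ->].
  have sub t : t \in y :: R2 -> t \in w :: R by rewrite E mem_cat => ->; rewrite orbT.
  have -> : (y \notin c) && all (predC (mem c)) R2.
    apply/andP; split; first by apply: Rc; rewrite inE yR orbT.
    by apply/allP => t tR; apply: Rc; rewrite inE sub ?orbT // inE tR orbT.
  have : size (w :: R) = size R1 + (size R2).+1 by rewrite E size_cat.
  move=> /= e /(_ isT); rewrite e.
  by move: (size R1) (size R2); clear => *; lia.
have one y a d : y \notin c -> a \in c -> d \in c -> adj y a -> adj y d -> a = d.
  move=> yc ac dc ya yd; apply/eqP/negPn/negP => nad.
  have := minR a d [:: y]; rewrite /ear ac dc nad /= yd yc adj_sym ya.
  by move/(_ isT).
have cf2 : conf ore u f b v g h x1 y1 S1 x2 y2 S2 z w [:: z; w].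
  apply: two_blobs_conf tb _ _ _ (sedge_ore uz) => //.
  - by rewrite /walk /= !eqxx sedge_ore.
  - by rewrite /= inE sedge_neq.
  - by move=> y; rewrite !inE => /orP[]/eqP->.
have nuw' : ~~ ore u w.
  pose z' := last w R.
  apply: (far_not_heavy claw_heavy cyc' longest' (v := v) (z := z) (z' := z') (R := w :: R)) => //.
  - by rewrite inc'.
  - by rewrite inc'.
  - by apply: nuw; exact: mem_head.
  - by move=> y a d; rewrite !inc'; apply: one.
  - by apply: walk_path; move: wR; rewrite rcons_path => /andP[].
  - by move: wR; rewrite rcons_path => /andP[].
  - by case/andP: UR.
  - by move=> y yR; rewrite inc'; split; [apply: Rc; rewrite inE yR orbT | apply: nuw].
apply: (no_long_leg claw_heavy N112_heavy cf Ublobs outside mu uz cl zw nuw').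
- move=> s; rewrite mem_cat => /orP[] sI; apply/negP.
    exact: (off_cycle_left ore_sym cf2).
  exact: (off_cycle_left ore_sym (conf_mirror ore_sym cf2)).
- by apply/negP; exact: (off_cycle_x1 ore_sym cf2).
- by apply/negP; exact: (off_cycle_x1 ore_sym (conf_mirror ore_sym cf2)).
Qed.

Lemma blob_ends u f b : blob ore u f b ->
  cov1 ore u (head u b) (u :: f ++ b) /\ cov1 ore u (head u f) (u :: b ++ f).
Proof.
move=> /(blob_covers ore_sym)[[H1 _ _] [H2 _ _]].
by split; [apply: cov1_perm H2 | apply: cov1_perm H1]; perm_count.
Qed.

Lemma ear_cover u v R f b g h s : ear c u v R -> uniq R ->
  cov1 ore u (head u b) (u :: f ++ b) -> cov1 ore v (head v h) (v :: g ++ h) ->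
  path adj v (rev h ++ rcons s (head u b)) ->
  perm_eq c ((u :: f ++ b) ++ (v :: g ++ h) ++ s) -> False.
Proof.
move=> eR UR [q1 w1 p1] [q2 w2 p2].
rewrite cat_path last_rev => /andP[_]; rewrite rcons_path => /andP[hs sb] pc.
have /and5P[uc vc uv pR /andP[aR sR]] := eR.
have [z [z' [uz wR zv]]] : exists z z', [/\ ore u z, walk ore z z' R & ore z' v].
  case: (R) pR sR => // z t /= /andP[uz]; rewrite rcons_path => /andP[zs lv] _.
  exists z, (last z t); split; try exact: sedge_ore; apply: walk_path.
  by apply: sub_path zs; exact: sedge_ore.
have hs' : path ore (head v h) s by apply: sub_path hs; exact: sedge_ore.
have w3 := walk_cat_path w2 hs'.
have w4 := walk_cat (walk_cat (walk_rev ore_sym w1) uz wR) zv w3.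
apply: (no_cover (R := R) _ UR _ w4 (sedge_ore sb)).
- by case: (R) sR.
- by move=> y /(allP aR).
- by perm_count.
Qed.

Lemma segment_walk (x y : G) X t g : path adj x X -> x :: X = rcons t y ++ g ->
  walk ore x y (rcons t y).
Proof.
move=> xX E; have [q qE] : exists q, rcons t y = x :: q.
  by case: t E => [|w t] /= [<- _]; eexists.
have lq : last x q = y by have := last_rcons x t y; rewrite qE.
move: E; rewrite qE -lq => -[E]; apply: walk_path.
by move: xX; rewrite E cat_path => /andP[xq _]; apply: sub_path xq; exact: sedge_ore.
Qed.

Lemma two_blobs_exist u v R : ear c u v R -> uniq R ->
  exists f b g h x1 y1 S1 x2 y2 S2, two_blobs u f b v g h x1 y1 S1 x2 y2 S2.
Proof.
move=> eR UR; have /and5P[uc vc uv pR /andP[aR sR]] := eR.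
have Rc y : y \in R -> y \notin c by move/(allP aR).
have [z [z' [zR z'R uz zv]]] : exists z z', [/\ z \in R, z' \in R, adj u z & adj z' v].
  case: (R) pR sR => // z t /= /andP[uz]; rewrite rcons_path => /andP[zs lv] _.
  by exists z, (last z t); split; rewrite ?mem_head ?mem_last.
have [i p cE] := rot_to uc.
have cyc' : ucycle adj (u :: p).
  by rewrite -cE; move: cyc; rewrite /ucycle rot_cycle rot_uniq.
have Uc' : uniq (u :: p) by case/andP: cyc'.
have longest' s : ucycle ore s -> size s <= size (u :: p) by rewrite -cE size_rot; apply: longest.
have c3' : 2 < size (u :: p) by rewrite -cE size_rot.
have inc' y : (y \in u :: p) = (y \in c) by rewrite -cE mem_rot.
have vp : v \in p by have := inc' v; rewrite vc inE eq_sym (negPf uv).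
have [A [B pE]] : exists A B, p = A ++ v :: B by case/splitPr: vp => A B; exists A, B.
have pc : perm_eq c (u :: A ++ v :: B) by rewrite -pE -cE perm_sym perm_rot.
have [pA pB] : path adj u (rcons A v) /\ path adj v (rcons B u).
  have : path adj u (rcons p u) by case/andP: cyc'.
  by rewrite pE rcons_cat rcons_cons -cat_rcons cat_path last_rcons => /andP[].
have flip a d s : path adj a (rcons s d) -> path adj d (rcons (rev s) a).
  move=> ps; have := rev_path adj a (rcons s d); rewrite last_rcons belast_rcons rev_cons => ->.
  by rewrite (eq_path (e' := adj)) // => x y; apply: adj_sym.
have [pA' pB'] := (flip _ _ _ pA, flip _ _ _ pB).
have triv (w : G) : cov1 ore w w [:: w] by exists [:: w]; rewrite ?walk1.
have lastB : prev (u :: p) u = last v B by rewrite last_prev // pE last_cat.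
have [pfA pfB] : path adj u A /\ path adj u (rev B).
  by move: pA pB'; rewrite !rcons_path => /andP[-> _] /andP[-> _].
have [||f [b [x1 [X [x2 [Y [AE BE bu mu]]]]]]] := @grow_blob G u A (rev B) pfA pfB.
- move=> f b X Y AE BE bl; have [Ef Eb] := blob_arms bl.
  have [c1 c2] := blob_ends bl.
  have BE' : B = rev Y ++ b by rewrite -(revK B) BE rev_cat revK.
  have AE' : rev A = rev X ++ f by rewrite AE rev_cat revK.
  split=> E.
    apply: (@ear_cover u v R f b [::] [::] (rev Y) eR UR c1 (triv v)).
      by move: pB; rewrite BE' {1}Eb rcons_cat rcons_cons -cat_rcons cat_path => /andP[].
    by apply: perm_trans pc _; rewrite BE' AE E; perm_count.
  apply: (@ear_cover u v R b f [::] [::] (rev X) eR UR c2 (triv v)).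
    by move: pA'; rewrite AE' {1}Ef rcons_cat rcons_cons -cat_rcons cat_path => /andP[].
  by apply: perm_trans pc _; rewrite BE' AE E; perm_count.
- case: A pE pc pA pA' {pfA} => [|x A'] pE pc pA pA'.
    case: (@ear_cover u v R [::] [::] [::] [::] B eR UR (triv u) (triv v) pB).
    by apply: perm_trans pc _; perm_count.
  case/lastP: B pE pc pB pB' lastB {pfB} => [|B' y] pE pc pB pB' lastB.
    case: (@ear_cover u v R [::] [::] [::] [::] (rev (x :: A')) eR UR (triv u) (triv v) pA').
    by apply: perm_trans pc _; perm_count.
  exists x, A', y, (rev B'); split=> //; first by rewrite rev_rcons.
  have : ore (prev (u :: p) u) (next (u :: p) u).
    apply: (bypass claw_heavy cyc' c3' longest' (z := z)); rewrite ?mem_head ?inc' ?Rc //.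
    by rewrite adj_sym.
  by rewrite lastB last_rcons pE /= eqxx ore_sym.
have BE' : B = rev (x2 :: Y) ++ b by rewrite -(revK B) BE rev_cat revK.
have AE' : rev A = rev (x1 :: X) ++ f by rewrite AE rev_cat revK.
have [Ef Eb] := blob_arms bu.
have [c1 c2] := blob_ends bu.
have qA : path adj v (rcons (rev (x1 :: X)) (head u f)).
  by move: pA'; rewrite AE' {1}Ef rcons_cat rcons_cons -cat_rcons cat_path => /andP[H _].
have qB : path adj v (rcons (rev (x2 :: Y)) (head u b)).
  by move: pB; rewrite BE' {1}Eb rcons_cat rcons_cons -cat_rcons cat_path => /andP[H _].
have [rA rB] : path adj v (rev (x1 :: X)) /\ path adj v (rev (x2 :: Y)).
  by move: qA qB; rewrite !rcons_path => /andP[-> _] /andP[-> _].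
have [||g [h [y1 [X3 [y2 [Y3 [gE hE bv mv]]]]]]] := @grow_blob G v _ _ rA rB.
- move=> g h X3 Y3 gE hE bl.
  have [d1 d2] := blob_ends bl.
  split=> E.
    apply: (@ear_cover u v R f b g h Y3 eR UR c1 d1).
      by move: qB; rewrite hE rcons_cat.
    apply: perm_trans pc _; rewrite AE BE' hE.
    have pg : perm_eq (x1 :: X) g by rewrite -(perm_rev (x1 :: X)) gE E cats0 perm_rev.
    by perm_count.
  apply: (@ear_cover u v R b f h g X3 eR UR c2 d2).
    by move: qA; rewrite gE rcons_cat.
  apply: perm_trans pc _; rewrite AE BE' hE E.
  have pg : perm_eq (x1 :: X) (g ++ X3).
    by rewrite -(perm_rev (x1 :: X)) gE perm_cat2r perm_rev.
  by perm_count.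
- have : ore (prev (u :: p) v) (next (u :: p) v).
    apply: (bypass claw_heavy cyc' c3' longest' (z := z')); rewrite ?inc' ?Rc //.
  have c1E : u :: p = belast u A ++ [:: last u A, v & B].
    by rewrite -[RHS]cat_rcons -lastI pE.
  rewrite {1}c1E prev_mid -?c1E //.
  have [y0 [B0 B0E]] : exists y0 B0, rev (x2 :: Y) = y0 :: B0.
    by case: (rev (x2 :: Y)) (size_rev (x2 :: Y)) => // y0 B0 _; exists y0, B0.
  have c2E : u :: p = (u :: A) ++ [:: v, y0 & B0 ++ b] by rewrite pE BE' B0E.
  rewrite {1}c2E next_mid -?c2E // => H.
  exists (last u A), (behead (rev (x1 :: X))), y0, B0; split=> //.
  have : last u A = last x1 X by rewrite AE last_cat.
  move=> ->; rewrite {1}lastI rev_rcons; congr cons.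
  by rewrite lastI rev_rcons.
have e1 : x1 :: X = rev (y1 :: X3) ++ g.
  by rewrite -(revK (x1 :: X)) gE rev_cat revK.
have e2 : x2 :: Y = rev (y2 :: Y3) ++ h.
  by rewrite -(revK (x2 :: Y)) hE rev_cat revK.
exists f, b, g, h, x1, y1, (rev (y1 :: X3)), x2, y2, (rev (y2 :: Y3)); split=> //.
- rewrite rev_cons; apply: (segment_walk (X := X) (g := g)); last by rewrite -rev_cons.
  by move: pfA; rewrite AE cat_path /= => /and3P[].
- rewrite rev_cons; apply: (segment_walk (X := Y) (g := h)); last by rewrite -rev_cons.
  by move: pfB; rewrite BE cat_path /= => /and3P[].
- by apply: perm_trans pc _; rewrite AE BE' e1 e2; perm_count.
Qed.

Lemma no_ear u v R : ear c u v R -> uniq R ->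
  (forall u' v' R', ear c u' v' R' -> size R <= size R') -> False.
Proof.
move=> eR UR minR.
have [f [b [g [h [x1 [y1 [S1 [x2 [y2 [S2 tb]]]]]]]]]] := two_blobs_exist eR UR.
have /and5P[uc vc uv pR /andP[aR sR]] := eR.
have Rc y : y \in R -> y \notin c by move/(allP aR).
have [z [z' [uz wR zv]]] : exists z z', [/\ adj u z, walk ore z z' R & adj z' v].
  case: (R) pR sR => // z s /= /andP[uz]; rewrite rcons_path => /andP[zs lv] _.
  exists z, (last z s); split=> //; apply: walk_path.
  by apply: sub_path zs; exact: sedge_ore.
have cf := two_blobs_conf tb wR UR Rc (sedge_ore uz).
have Ublobs : uniq ((u :: f ++ b) ++ (v :: g ++ h)).
  have := perm_uniq (tb_c tb); rewrite Uc catA cat_uniq => /esym/andP[].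
  by [].
case: (one_blob_clean cf (sedge_ore zv) Ublobs) => cl.
  exact: clean_blob_false tb eR UR minR cl.
apply: (clean_blob_false (two_blobs_swap tb) (ear_rev eR) _ _ cl); first by rewrite rev_uniq.
by move=> u' v' R' /minR; rewrite size_rev.
Qed.

End LongestCycle.

Lemma longest_cycle_exists (G : sgraph) : k_connected 2 G ->
  exists c : seq G, [/\ ucycle (@sedge G) c, 2 < size c &
    forall s, ucycle (@sedge G) s -> size s <= size c].
Proof.
move=> conn2; have [c cyc c3] := cycle_exists conn2.
pose P n := [exists t : n.-tuple G, cycle (@sedge G) t && uniq t].
have Pseq s : ucycle (@sedge G) s -> P (size s).
  by case/andP=> cs us; apply/existsP; exists (in_tuple s); rewrite cs.
have bound n : P n -> n <= #|G|.
  by case/existsP=> t /andP[_ ut]; rewrite -(size_tuple t) -(card_uniqP ut) max_card.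
have [n /existsP[t /andP[ct ut]] max_n] := ex_maxnP (ex_intro P _ (Pseq _ cyc)) bound.
exists t; rewrite size_tuple; split; first exact/andP.
  exact: leq_trans c3 (max_n _ (Pseq _ cyc)).
by move=> s /Pseq/max_n.
Qed.

Lemma shortest_ear_exists (G : sgraph) (c : seq G) u v R : ear c u v R ->
  exists u' v' R', [/\ ear c u' v' R', uniq R' &
    forall u1 v1 R1, ear c u1 v1 R1 -> size R' <= size R1].
Proof.
move=> eR.
pose P n := [exists x, exists y, exists t : n.-tuple G, ear c x y t].
have Pear x y s : ear c x y s -> P (size s).
  by move=> es; apply/existsP; exists x; apply/existsP; exists y; apply/existsP; exists (in_tuple s).
have [n /existsP[x /existsP[y /existsP[t et]]] min_n] := ex_minnP (ex_intro P _ (Pear _ _ _ eR)).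
have [R' [eR' uR' sR']] := ear_uniq et.
exists x, y, R'; split=> // u1 v1 R1 /Pear/min_n; apply: leq_trans.
by rewrite -[n](size_tuple t).
Qed.

Theorem theorem8 (G : sgraph) :
  k_connected 2 G -> family_heavy [:: claw; N112; deer] G -> hamiltonian G.
Proof.
move=> conn2 heavyG.
have clawG : graph_heavy claw G by apply: heavyG; left.
have N112G : graph_heavy N112 G by apply: heavyG; right; left.
have deerG : graph_heavy deer G by apply: heavyG; right; right; left.
have [c [cyc c3 maxc]] := longest_cycle_exists conn2.
exists c; split=> // t; apply: contraT => tc.
have longest s : ucycle (@ore_adj G) s -> size s <= size c.
  have [s2 _|s3 us] := leqP (size s) 2; first exact: leq_trans s2 (ltnW c3).
  by have [c' [/maxc c'c sc' _]] := ore_cover us s3; apply: leq_trans c'c.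
have [u1 [u2 [u1c u2c u12]]] : exists u1 u2, [/\ u1 \in c, u2 \in c & u1 != u2].
  case/andP: cyc => _; case: (c) c3 => [|x [|y s]] //= _ /and3P[]; rewrite inE negb_or.
  by case/andP=> xy _ _ _; exists x, y; rewrite !inE !eqxx orbT.
have [u [v [R eR]]] := ear_exists conn2 u1c u2c u12 tc.
have [u' [v' [R' [eR' UR' minR']]]] := shortest_ear_exists eR.
by case: (no_ear clawG N112G deerG cyc c3 longest eR' UR' minR').
Qed.
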